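(* Consider families (indexed by $\eta\in\mathbb N$) of two-sided queueing systems with $n$ customer types and $n$ server types on a bipartite graph that has a perfect matching, operated under the fluid pricing policy with buffer $q^\eta_{\max}$: $$\lambda_j(\mathbf q)=\eta\lambda_j^*\,\mathbf 1\{q_j^{(c)}<q_{\max}^\eta\},\qquad \mu_i(\mathbf q)=\eta\mu_i^*\,\mathbf 1\{q_i^{(s)}<q_{\max}^\eta\}.$$ (i) Under randomized matching, for $q_{\max}^\eta=\gamma\eta^{1/2}$, $L^\eta=O(\eta^{1/2})$. (ii) Under randomized matching with $q_{\max}^\eta=\gamma\eta^{1/2}$, for any $\gamma>0$ there exists $(\boldsymbol\lambda^*,\boldsymbol\mu^*,\boldsymbol\chi^* )$ satisfying the complete resource pooling condition and the perfect matching condition such that $$\liminf_{\eta\to\infty}\frac{L^\eta}{\eta^{1/2}}=\Omega(n).$$ (iii) Under max-weight matching (with the complete resource pooling condition in force) and $q_{\max}^\eta=\sqrt{\eta/n}$, $$\limsup_{\eta\to\infty}\frac{L^\eta}{\eta^{1/2}}\le n^{1/2}\left(\frac{\sum_{j}\lambda_j^*+\sum_i\mu_i^*}{2n}\max_{j}F_j(\lambda_j^* )+2\max_{i\in N,j\in M}\{s_i^{(s)},s_j^{(c)}\}\right)=O(n^{1/2}).$$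
   Context: **Model.** $N$ is a set of $n$ server types, $M$ a set of $m$ customer types (here $m=n$), $E\subseteq N\times M$ the set of compatible pairs. The state $\mathbf q=(q^{(c)}_j,j\in M;\ q^{(s)}_i,i\in N)\in\mathbb Z_+^{m+n}$ records the numbers of waiting customers and servers of each type. In state $\mathbf q$, type-$j$ customers arrive at Poisson rate $\lambda_j(\mathbf q)$ and type-$i$ servers at Poisson rate $\mu_i(\mathbf q)$, chosen by the operator (pricing). A matched compatible pair leaves at once. **Curves.** $F_j$ (inverse demand curve) is strictly decreasing, $G_i$ (inverse supply curve) is strictly increasing; both are nonnegative and twice continuously differentiable on the range of feasible rates, $\lambda\mapsto\lambda F_j(\lambda)$ has strictly negative second derivative, $\mu\mapsto\mu G_i(\mu)$ has strictly positive second derivative. Unit waiting costs $s_j^{(c)},s_i^{(s)}>0$ are given. **Fluid problem.** $\gamma^*=\max\sum_j\lambda_jF_j(\lambda_j)-\sum_i\mu_iG_i(\mu_i)$ over $\boldsymbol\lambda,\boldsymbol\mu,\boldsymbol\chi$ subject to $\lambda_j=\sum_i\chi_{ij}$, $\mu_i=\sum_j\chi_{ij}$, $\chi_{ij}\ge0$ for $(i,j)\in E$ and $\chi_{ij}=0$ for $(i,j)\notin E$. $(\boldsymbol\lambda^*,\boldsymbol\mu^*,\boldsymbol\chi^* )$ denotes an optimal solution; it is assumed that $\boldsymbol\lambda^*,\boldsymbol\mu^*>0$. **Scaling.** The $\eta$-th system has the same graph and waiting costs, with curves $F^\eta_j(\eta\lambda)=F_j(\lambda)$, $G_i^\eta(\eta\mu)=G_i(\mu)$;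 its fluid optimum is $\eta\gamma^*$. Here $\gamma$ is a positive constant; $O(\cdot)$ in (i) is as $\eta\to\infty$, while $\Omega(n)$ and $O(n^{1/2})$ describe the dependence on the number of types $n$. **Profit loss.** With $\mathbb E$ the stationary expectation, $$L^\eta=\eta\gamma^*-\Big(\mathbb E\Big[\sum_j\lambda_j(\mathbf q)F_j^\eta(\lambda_j(\mathbf q))-\sum_i\mu_i(\mathbf q)G_i^\eta(\mu_i(\mathbf q))\Big]-\sum_js_j^{(c)}\mathbb E[q_j^{(c)}]-\sum_is_i^{(s)}\mathbb E[q_i^{(s)}]\Big).$$ **Max-weight matching.** An arriving server of type $i$ is immediately matched with a waiting customer of a type $j$ maximizing $q_j^{(c)}$ over $\{j:(i,j)\in E\}$ if this maximum is positive; symmetrically for an arriving customer. Ties are broken arbitrarily. If all compatible queues are empty, the arrival joins its own queue. **Randomized matching** (for a given fluid solution $\boldsymbol\chi^*$). An arriving server of type $i$ is matched with a waiting type-$j$ customer with probability $\chi^*_{ij}\mathbf 1\{q_j^{(c)}>0\}/\sum_{j'}\chi^*_{ij'}\mathbf 1\{q_{j'}^{(c)}>0\}$; an arriving customer of type $j$ is matched with a waiting type-$i$ server with probability $\chi^*_{ij}\mathbf 1\{q_i^{(s)}>0\}/\sum_{i'}\chi^*_{i'j}\mathbf 1\{q_{i'}^{(s)}>0\}$. If the denominator is zero, the arrival joins its own queue. **Perfect matching condition.** The graph has a perfect matching; without loss of generality server type $i$ is compatible with customer type $i$ for each $i\in\{1,\dots,n\}$. **Complete resource pooling condition.** There is an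 optimal fluid solution $(\boldsymbol\lambda^*,\boldsymbol\mu^* )$ such that for all nonempty $J\subsetneq M$ and nonempty $I\subsetneq N$, $$\sum_{j\in J}\lambda_j^*<\sum_{i:\exists j\in J,(i,j)\in E}\mu_i^*,\qquad \sum_{i\in I}\mu_i^*<\sum_{j:\exists i\in I,(i,j)\in E}\lambda_j^*.$$ *)

(* Defs.v *)
From mathcomp Require Import all_boot all_order all_algebra.
From mathcomp Require Import all_classical all_reals all_analysis.
Set Implicit Arguments.
Unset Strict Implicit.
Unset Printing Implicit Defensive.
Import Order.TTheory GRing.Theory Num.Theory.
Import numFieldNormedType.Exports.
Local Open Scope classical_set_scope.
Local Open Scope ring_scope.

(* Throughout, [i] ranges over server types and [j] over customer types, and
   [compat M i j] means that server type [i] can serve customer type [j].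
   The curves are total functions; only their values on the ranges of feasible
   rates matter. *)
Record market (R : realType) (n : nat) := Market {
  compat : 'I_n -> 'I_n -> bool;
  demand : 'I_n -> R -> R;              (* F_j *)
  supply : 'I_n -> R -> R;              (* G_i *)
  demand_range : 'I_n -> set R;         (* feasible rates of customer type j *)
  supply_range : 'I_n -> set R;         (* feasible rates of server type i *)
  cost_c : 'I_n -> R;
  cost_s : 'I_n -> R }.

(* Differentiability is asked on a neighbourhood of [x]: at an endpoint of a
   range of feasible rates this is C^2 regularity of an extension. *)
Definition C2_at (R : realType) (f : R -> R) (x : R) : Prop :=
  (\forall y \near x, derivable f y 1 /\ derivable (derive1 f) y 1) /\
  {for x, continuous (derive1n 2 f)}.

(* The rate 0 is feasible: it is the rate set when a buffer is full. *)
Definition rate_range (R : realType) (D : set R) : Prop :=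
  [/\ is_interval D, D 0 & forall x, D x -> 0 <= x].

Definition demand_curve (R : realType) (D : set R) (F : R -> R) : Prop :=
  [/\ forall x, D x -> 0 <= F x,
      forall x y, D x -> D y -> x < y -> F y < F x,
      forall x, D x -> C2_at F x
    & forall x, D x -> derive1n 2 (fun l : R => l * F l) x < 0].

Definition supply_curve (R : realType) (D : set R) (G : R -> R) : Prop :=
  [/\ forall x, D x -> 0 <= G x,
      forall x y, D x -> D y -> x < y -> G x < G y,
      forall x, D x -> C2_at G x
    & forall x, D x -> 0 < derive1n 2 (fun u : R => u * G u) x].

Definition valid_market (R : realType) (n : nat) (M : market R n) : Prop :=
  [/\ forall j, rate_range (demand_range M j) /\
                demand_curve (demand_range M j) (demand M j),
      forall i, rate_range (supply_range M i) /\
                supply_curve (supply_range M i) (supply M i),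
      forall j, 0 < cost_c M j
    & forall i, 0 < cost_s M i].

Definition perfect_matching (R : realType) (n : nat) (M : market R n) : Prop :=
  exists2 s : 'I_n -> 'I_n, bijective s & forall i, compat M i (s i).

Definition fluid_feasible (R : realType) (n : nat) (M : market R n)
    (lam mu : 'I_n -> R) (chi : 'I_n -> 'I_n -> R) : Prop :=
  [/\ (forall j, demand_range M j (lam j)) /\
      (forall i, supply_range M i (mu i)),
      forall j, lam j = \sum_i chi i j,
      forall i, mu i = \sum_j chi i j,
      forall i j, compat M i j -> 0 <= chi i j
    & forall i j, ~~ compat M i j -> chi i j = 0].

Definition fluid_profit (R : realType) (n : nat) (M : market R n)
    (lam mu : 'I_n -> R) : R :=
  \sum_j lam j * demand M j (lam j) - \sum_i mu i * supply M i (mu i).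

Definition fluid_optimal (R : realType) (n : nat) (M : market R n)
    (lam mu : 'I_n -> R) (chi : 'I_n -> 'I_n -> R) : Prop :=
  fluid_feasible M lam mu chi /\
  forall lam' mu' chi', fluid_feasible M lam' mu' chi' ->
    fluid_profit M lam' mu' <= fluid_profit M lam mu.

Definition fluid_value (R : realType) (n : nat) (M : market R n) : R :=
  sup [set v | exists lam mu chi,
         fluid_feasible M lam mu chi /\ v = fluid_profit M lam mu].

Definition pooling (R : realType) (n : nat) (M : market R n)
    (lam mu : 'I_n -> R) : Prop :=
  (forall J : {set 'I_n}, J != finset.set0 -> J != finset.setT ->
     \sum_(j in J) lam j < \sum_(i | [exists j in J, compat M i j]) mu i) /\
  (forall I : {set 'I_n}, I != finset.set0 -> I != finset.setT ->
     \sum_(i in I) mu i < \sum_(j | [exists i in I, compat M i j]) lam j).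

Definition fluid_setting (R : realType) (n : nat) (M : market R n)
    (lam mu : 'I_n -> R) (chi : 'I_n -> 'I_n -> R) : Prop :=
  [/\ valid_market M, perfect_matching M, fluid_optimal M lam mu chi,
      forall j, 0 < lam j & forall i, 0 < mu i].

(* Numbers of waiting customers (first component) and servers (second one). *)
Definition state (n : nat) : Type :=
  ({ffun 'I_n -> nat} * {ffun 'I_n -> nat})%type.

Definition qc (n : nat) (q : state n) (j : 'I_n) : nat := q.1 j.
Definition qs (n : nat) (q : state n) (i : 'I_n) : nat := q.2 i.

Definition join_queue (n : nat) (f : {ffun 'I_n -> nat}) (k : 'I_n) :=
  [ffun l => (f l + (l == k))%N].
Definition leave_queue (n : nat) (f : {ffun 'I_n -> nat}) (k : 'I_n) :=
  [ffun l => (f l - (l == k))%N].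

(* [match_s q i j]: probability that a server of type [i] arriving in state [q]
   is matched with a waiting customer of type [j]; [match_c q j i]: probability
   that an arriving customer of type [j] is matched with a waiting server of
   type [i]. With the remaining probability the arrival joins its own queue. *)
Record matching (R : realType) (n : nat) := Matching {
  match_s : state n -> 'I_n -> 'I_n -> R;
  match_c : state n -> 'I_n -> 'I_n -> R }.

(* When the denominator vanishes, so do the numerators, and the arrival joins
   its own queue with probability 1. *)
Definition randomized (R : realType) (n : nat) (chi : 'I_n -> 'I_n -> R) :
    matching R n :=
  {| match_s := fun q i j => chi i j * (0 < qc q j)%N%:R /
                             \sum_j' chi i j' * (0 < qc q j')%N%:R;
     match_c := fun q j i => chi i j * (0 < qs q i)%N%:R /
                             \sum_i' chi i' j * (0 < qs q i')%N%:R |}.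

(* [p] is a matching distribution of an arrival that is compatible with the
   types in [comp], whose queue lengths are [len]: some longest compatible
   nonempty queue is served, if there is one. Arbitrary tie-breaking: [p] is
   any distribution (e.g. a Dirac mass) on the set of maximizers. *)
Definition longest_queue (R : realType) (n : nat) (comp : 'I_n -> bool)
    (len : 'I_n -> nat) (p : 'I_n -> R) : Prop :=
  [/\ forall k, 0 <= p k,
      forall k, p k != 0 -> [/\ comp k, (0 < len k)%N
                 & forall l, comp l -> (len l <= len k)%N]
    & (exists k, comp k /\ (0 < len k)%N) -> \sum_k p k = 1].

Definition max_weight (R : realType) (n : nat) (M : market R n)
    (mt : matching R n) : Prop :=
  forall q : state n,
    (forall i, longest_queue (fun j => compat M i j) (qc q) (match_s mt q i)) /\
    (forall j, longest_queue (fun i => compat M i j) (qs q) (match_c mt q j)).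

(* Jump rate from [q] to [q'] under arrival rates [lamq], [muq]. *)
Definition jump_rate (R : realType) (n : nat)
    (lamq muq : state n -> 'I_n -> R) (mt : matching R n) (q q' : state n) : R :=
  \sum_j lamq q j *
    (\sum_i match_c mt q j i * (q' == (q.1, leave_queue q.2 i))%:R +
     (1 - \sum_i match_c mt q j i) * (q' == (join_queue q.1 j, q.2))%:R) +
  \sum_i muq q i *
    (\sum_j match_s mt q i j * (q' == (leave_queue q.1 j, q.2))%:R +
     (1 - \sum_j match_s mt q i j) * (q' == (q.1, join_queue q.2 i))%:R).

Definition empty_state (n : nat) : state n := ([ffun=> 0%N], [ffun=> 0%N]).

Inductive reachable (R : realType) (n : nat) (rate : state n -> state n -> R) :
    state n -> Prop :=
| reach_empty : reachable rate (empty_state n)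
| reach_jump q q' : reachable rate q -> 0 < rate q q' -> reachable rate q'.

(* Stationary distribution of the system started empty. The restriction to
   reachable states matters: e.g. the state in which all buffers are full is
   absorbing, but it is never reached. The sums [\sum_(q \in setT)] are over
   the support of the summand and are meant for finite supports; under a
   finite buffer there are finitely many reachable states. *)
Definition stationary (R : realType) (n : nat) (lamq muq : state n -> 'I_n -> R)
    (mt : matching R n) (p : state n -> R) : Prop :=
  [/\ forall q, 0 <= p q,
      forall q, p q != 0 -> reachable (jump_rate lamq muq mt) q,
      finite_set [set q | p q != 0],
      \sum_(q \in [set: state n]) p q = 1
    & forall q', \sum_(q \in [set: state n]) p q * jump_rate lamq muq mt q q' =
                 p q' * (\sum_j lamq q' j + \sum_i muq q' i)].

(* Under the policies considered here the empty state is accessible from every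
   reachable state, so that there is exactly one stationary distribution. *)
Definition stationary_dist (R : realType) (n : nat)
    (lamq muq : state n -> 'I_n -> R) (mt : matching R n) : state n -> R :=
  xget (fun=> 0) (stationary lamq muq mt).

Definition mean (R : realType) (n : nat) (p f : state n -> R) : R :=
  \sum_(q \in [set: state n]) p q * f q.

(* The curves of the eta-th system are F_j(x / eta) and G_i(x / eta). *)
Definition profit_loss (R : realType) (n : nat) (M : market R n) (eta : nat)
    (lamq muq : state n -> 'I_n -> R) (mt : matching R n) : R :=
  let E := mean (stationary_dist lamq muq mt) in
  eta%:R * fluid_value M -
  (E (fun q => \sum_j lamq q j * demand M j (lamq q j / eta%:R) -
               \sum_i muq q i * supply M i (muq q i / eta%:R))
   - \sum_j cost_c M j * E (fun q => (qc q j)%:R)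
   - \sum_i cost_s M i * E (fun q => (qs q i)%:R)).

Definition fluid_price (R : realType) (n : nat) (eta : nat) (qmax : R)
    (nominal : 'I_n -> R) (len : state n -> 'I_n -> nat) :
    state n -> 'I_n -> R :=
  fun q k => eta%:R * nominal k * ((len q k)%:R < qmax)%R%:R.

Definition fluid_loss (R : realType) (n : nat) (M : market R n)
    (lam mu : 'I_n -> R) (mt : matching R n) (qmax : R) (eta : nat) : R :=
  profit_loss M eta (fluid_price eta qmax lam (@qc n))
    (fluid_price eta qmax mu (@qs n)) mt.

(* Prices at the fluid optimum and unit costs are nonnegative, so that the
   maxima may be started at 0. *)
Definition max_weight_bound (R : realType) (n : nat) (M : market R n)
    (lam mu : 'I_n -> R) : R :=
  Num.sqrt n%:R *
  ((\sum_j lam j + \sum_i mu i) / (2 * n%:R) *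
     (\big[Num.max/0]_j demand M j (lam j)) +
   2 * Num.max (\big[Num.max/0]_i cost_s M i) (\big[Num.max/0]_j cost_c M j)).

(* Dependence on the number of types is understood for families of systems
   whose data are bounded by a constant not depending on [n]. *)
Definition data_le (R : realType) (n : nat) (M : market R n)
    (lam mu : 'I_n -> R) (C : R) : Prop :=
  (forall j, [/\ lam j <= C, demand M j (lam j) <= C & cost_c M j <= C]) /\
  (forall i, mu i <= C /\ cost_s M i <= C).

(* Main.v *)
(* Let K be the least integer not below q_max. Testing stationarity against a
   function f of the state (the mean of the generator applied to f vanishes)
   gives everything; a stationary distribution exists because the reachable set
   is finite.

   (i) A nonempty queue j faces empty adjacent queues, hence service at rate at
   least its arrival rate; f = q_j (q_j + 1) gives P(q_j full) <= 1 / (K + 1).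

   (ii) With chi the identity matrix the system splits into n symmetric random
   walks z_i = q_i^c - q_i^s on {-K, ..., K}; f = z_i and f = z_i^2 give
   P(q_i full) = 1 / (2 K + 1) on both sides, and each blocked pair of types
   loses a fixed profit margin.

   (iii) Let z be the total number of customers minus that of servers, and S the
   sum over both sides of the difference between the longest and the shortest
   queue. Resource pooling gives V = |q|^2 - z^2 / n a drift of at most
   a constant minus 2 eps S, while V is of order S^2; f = V^2 then bounds E[S^2]
   uniformly in K. A full queue forces |z| >= n (K - S), so f = z^2 shows that the
   blocking probabilities weighted by the arrival rates are about
   sum_j lambda_j / (2 n K), half of what is needed. *)
Require Import Defs.
From mathcomp Require Import all_boot all_order all_algebra.
From mathcomp Require Import finmap.
From mathcomp Require Import all_classical all_reals all_analysis.
From mathcomp Require Import ring lra zify.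
Set Implicit Arguments.
Unset Strict Implicit.
Unset Printing Implicit Defensive.
Import Order.TTheory GRing.Theory Num.Theory.
Import numFieldNormedType.Exports.
Local Open Scope classical_set_scope.
Local Open Scope ring_scope.

(** * Stationary distributions *)

Lemma invariant_vector (R : realFieldType) (N : nat)
    (r : 'I_N.+1 -> 'I_N.+1 -> R) :
  (forall x y, 0 <= r x y) ->
  exists v : 'I_N.+1 -> R, [/\ forall x, 0 <= v x, \sum_x v x = 1 &
    forall y, \sum_x v x * r x y = v y * \sum_z r y z].
Proof.
move=> r0.
pose Q : 'M[R]_N.+1 := \matrix_(x, y) (r x y - (x == y)%:R * \sum_z r y z).
have Q1 : Q *m const_mx (n := 1) 1 = 0.
  apply/matrixP => x y; rewrite !mxE.
  under eq_bigr => z _ do rewrite !mxE mulr1.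
  rewrite sumrB (bigD1 x) //= [X in _ - X](bigD1 x) //= eqxx mul1r.
  rewrite [X in _ - (_ + X)]big1 => [|z zx]; last first.
    by rewrite eq_sym (negbTE zx) mul0r.
  by rewrite addr0 [X in _ - X](bigD1 x) //= subrr.
have kQ : kermx Q != 0.
  rewrite kermx_eq0 row_free_unit; apply/negP => uQ.
  have := mulKmx uQ (const_mx (n := 1) 1); rewrite Q1 mulmx0 => /matrixP.
  by move=> /(_ ord0 ord0); rewrite !mxE => /eqP; rewrite eq_sym oner_eq0.
have /rowV0Pn[v /sub_kermxP vQ v0] := kQ.
have bal y : \sum_x v 0 x * r x y = v 0 y * \sum_z r y z.
  have /matrixP /(_ ord0 y) := vQ; rewrite !mxE.
  under eq_bigr => z _ do rewrite !mxE mulrBr.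
  rewrite sumrB [X in _ - X](bigD1 y) //= eqxx mul1r.
  rewrite [X in _ - (_ + X)]big1 => [|z zx]; last first.
    by rewrite (negbTE zx) mul0r mulr0.
  by rewrite addr0 => /eqP; rewrite subr_eq0 => /eqP.
have le y : `|v 0 y| * \sum_z r y z <= \sum_x `|v 0 x| * r x y.
  have s0 : 0 <= \sum_z r y z by rewrite sumr_ge0.
  rewrite -{1}(ger0_norm s0) -normrM -bal.
  apply: le_trans (ler_norm_sum _ _ _) _; apply: ler_sum => x _.
  by rewrite normrM (ger0_norm (r0 _ _)).
(* Both sides of [le] have the same sum over [y], so none of these inequalities can be strict. *)
have abal y : \sum_x `|v 0 x| * r x y = `|v 0 y| * \sum_z r y z.
  have tot : \sum_y (\sum_x `|v 0 x| * r x y - `|v 0 y| * \sum_z r y z) = 0.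
    rewrite sumrB exchange_big /=; apply/eqP; rewrite subr_eq0; apply/eqP.
    by apply: eq_bigr => x _; rewrite mulr_sumr.
  have /psumr_eq0P : forall z, true ->
    0 <= \sum_x `|v 0 x| * r x z - `|v 0 z| * \sum_t r z t.
    by move=> z _; rewrite subr_ge0.
  by move=> /(_ tot y isT) /eqP; rewrite subr_eq0 => /eqP.
pose s := \sum_x `|v 0 x|.
have s0 : 0 < s.
  rewrite lt_def sumr_ge0 // andbT; apply: contra_neq v0 => s0.
  apply/rowP => x; rewrite mxE; apply/eqP; rewrite -normr_eq0; apply/eqP.
  by apply: (psumr_eq0P _ s0) => // z _.
exists (fun x => `|v 0 x| / s); split => [x||y].
- by rewrite divr_ge0 // ltW.
- by rewrite -mulr_suml divff // gt_eqF.
- rewrite mulrAC -abal mulr_suml.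
  by apply: eq_bigr => x _; rewrite mulrAC.
Qed.

Lemma invariant_vector_fin (R : realFieldType) (T : finType) (t0 : T)
    (r : T -> T -> R) :
  (forall x y, 0 <= r x y) ->
  exists v : T -> R, [/\ forall x, 0 <= v x, \sum_x v x = 1 &
    forall y, \sum_x v x * r x y = v y * \sum_z r y z].
Proof.
move=> r0; have /card_gt0P : exists t : T, t \in T by exists t0.
have re F : \sum_(x : T) F x = \sum_(i < #|T|) F (enum_val i) :> R.
  by rewrite (reindex _ (onW_bij _ (@enum_val_bij T))).
(* Abstracting the enumeration maps makes the cardinal of [T] a free number, which can then be
   replaced by a successor; [t0] excludes zero. *)
move: re (@enum_rankK T) (@enum_valK T); rewrite /=.
move: (@enum_rank T) (@enum_val T T).
case: #|T| => // N rk vl re rkK vlK _.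
have [v [v0 v1 vb]] :=
  @invariant_vector R N (fun x y => r (vl x) (vl y)) (fun _ _ => r0 _ _).
exists (v \o rk); split => [x||y] /=; first exact: v0.
- by rewrite re -v1; apply: eq_bigr => i _; rewrite /= vlK.
- rewrite !re; have := vb (rk y); rewrite rkK => <-.
  by apply: eq_bigr => i _; rewrite vlK.
Qed.

(** Mean increment of [f] caused by one arrival. The arguments are ordered by the arriving side and
    the opposite side, so that the same formula serves customers and servers. *)
Definition arrival (R : realType) (n : nat) (m : 'I_n -> R)
    (own other : {ffun 'I_n -> nat}) (k : 'I_n)
    (f : {ffun 'I_n -> nat} -> {ffun 'I_n -> nat} -> R) : R :=
  \sum_i m i * (f own (leave_queue other i) - f own other) +
  (1 - \sum_i m i) * (f (join_queue own k) other - f own other).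

Definition generator (R : realType) (n : nat)
    (lamq muq : state n -> 'I_n -> R) (mt : matching R n)
    (f : state n -> R) (q : state n) : R :=
  \sum_j lamq q j *
    arrival (match_c mt q j) q.1 q.2 j (fun a b => f (a, b)) +
  \sum_i muq q i *
    arrival (match_s mt q i) q.2 q.1 i (fun a b => f (b, a)).

Lemma sum_delta_seq (R : pzRingType) (T : eqType) (s : seq T) (a : T)
    (g : T -> R) : uniq s -> a \in s -> \sum_(x <- s) (x == a)%:R * g x = g a.
Proof.
move=> us sa; rewrite (bigD1_seq a) //= eqxx mul1r big1 ?addr0 // => x xa.
by rewrite (negbTE xa) mul0r.
Qed.

Section Jumps.
Variables (R : realType) (n : nat).
Implicit Types (lamq muq : state n -> 'I_n -> R) (mt : matching R n).

Lemma sum_mixture (T : eqType) (s : seq T) (L c : 'I_n -> R)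
    (m : 'I_n -> 'I_n -> R) (a b : 'I_n -> T) (f : T -> R) :
  uniq s -> (forall i, a i \in s) -> (forall j, b j \in s) ->
  \sum_(x <- s) (\sum_j L j * (\sum_i m j i * (x == a i)%:R +
                               c j * (x == b j)%:R)) * f x =
  \sum_j L j * (\sum_i m j i * f (a i) + c j * f (b j)).
Proof.
move=> us sa sb; under [LHS]eq_bigr => x _ do rewrite mulr_suml.
rewrite exchange_big /=; apply: eq_bigr => j _.
under eq_bigr => x _ do rewrite -mulrA.
rewrite -mulr_sumr; congr (_ * _).
under [LHS]eq_bigr => x _ do rewrite mulrDl.
rewrite big_split /=; congr (_ + _).
  under [LHS]eq_bigr => x _ do rewrite mulr_suml.
  rewrite exchange_big /=; apply: eq_bigr => i _.
  under eq_bigr => x _ do rewrite -mulrA.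
  by rewrite -mulr_sumr sum_delta_seq.
under eq_bigr => x _ do rewrite -mulrA.
by rewrite -mulr_sumr sum_delta_seq.
Qed.

(** Reads off the possible jumps from a nonzero rate. The alternative for a match keeps no
    information on the weights, because departures preserve [good] unconditionally. *)
Lemma mixture_neq0 (T : eqType) (x : T) (L c : 'I_n -> R)
    (m : 'I_n -> 'I_n -> R) (a b : 'I_n -> T) :
  \sum_j L j * (\sum_i m j i * (x == a i)%:R + c j * (x == b j)%:R) != 0 ->
  (exists i, x = a i) \/ (exists j, [/\ L j != 0, c j != 0 & x = b j]).
Proof.
move=> /eqP; apply: contra_notP => /not_orP[/forallNP xa /forallNP xb].
apply: big1 => j _; rewrite big1 => [|i _]; last first.
  by have /eqP/negbTE -> := xa i; rewrite mulr0.
rewrite add0r; apply/eqP; apply: contra_notT (xb j).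
by rewrite !mulf_eq0 !negb_or pnatr_eq0 eqb0 negbK => /and3P[-> -> /eqP ->].
Qed.

Definition successors (q : state n) : seq (state n) :=
  [seq (q.1, leave_queue q.2 i) | i <- enum 'I_n] ++
  [seq (join_queue q.1 j, q.2) | j <- enum 'I_n] ++
  [seq (leave_queue q.1 j, q.2) | j <- enum 'I_n] ++
  [seq (q.1, join_queue q.2 i) | i <- enum 'I_n].

(** The matching weights and the joining weight add up to 1, so each arrival takes off [f q] exactly
    once in the generator; the last term restores it. Nonnegativity of the weights does not
    enter. *)
Lemma jump_rate_sum lamq muq mt (q : state n) (s : seq (state n))
    (f : state n -> R) : uniq s -> {subset successors q <= s} ->
  \sum_(q' <- s) jump_rate lamq muq mt q q' * f q' =
  generator lamq muq mt f q + (\sum_j lamq q j + \sum_i muq q i) * f q.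
Proof.
move=> us ss; under [LHS]eq_bigr => x _ do rewrite /jump_rate mulrDl.
have mem k (g : 'I_n -> state n) : g k \in [seq g i | i <- enum 'I_n].
  by apply: map_f; rewrite mem_enum.
have m1 i : (q.1, leave_queue q.2 i) \in s.
  by apply: ss; rewrite !mem_cat (mem i (fun i => (q.1, leave_queue q.2 i))).
have m2 j : (join_queue q.1 j, q.2) \in s.
  by apply: ss; rewrite !mem_cat (mem j (fun j => (join_queue q.1 j, q.2))) orbT.
have m3 j : (leave_queue q.1 j, q.2) \in s.
  apply: ss; rewrite !mem_cat (mem j (fun j => (leave_queue q.1 j, q.2))).
  by rewrite !orbT.
have m4 i : (q.1, join_queue q.2 i) \in s.
  by apply: ss; rewrite !mem_cat (mem i (fun i => (q.1, join_queue q.2 i))) !orbT.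
rewrite big_split /= !sum_mixture //.
rewrite /generator mulrDl !mulr_suml addrACA.
have E (m : 'I_n -> R) (x z : R) (y : 'I_n -> R) :
    \sum_i m i * y i + (1 - \sum_i m i) * x =
    \sum_i m i * (y i - z) + (1 - \sum_i m i) * (x - z) + z.
  under [in RHS]eq_bigr => i _ do rewrite mulrBr.
  by rewrite sumrB -mulr_suml; ring.
have -> : f q = f (q.1, q.2) by case: (q).
by congr (_ + _); rewrite -big_split /=; apply: eq_bigr => k _;
  rewrite (E _ _ (f (q.1, q.2))) mulrDr.
Qed.

Lemma mean_seq (p f : state n -> R) (A : {fset state n}) :
  (forall q, q \notin A -> p q = 0) -> mean p f = \sum_(q <- A) p q * f q.
Proof. by move=> pA; apply: fsbigTE => q /pA ->; rewrite mul0r. Qed.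

Lemma generator_cst lamq muq mt (c : R) (q : state n) :
  generator lamq muq mt (fun=> c) q = 0.
Proof.
rewrite /generator /arrival subrr; under [X in X + _]eq_bigr => j _.
  by rewrite mulr0 addr0 big1 ?mulr0 => [|i _]; rewrite ?mulr0 //; over.
rewrite big1 // add0r big1 // => i _.
by rewrite mulr0 addr0 big1 ?mulr0 // => j _; rewrite mulr0.
Qed.

(** Sum the balance equations against [f] and exchange the two finite sums: the outflow term is what
    [jump_rate_sum] adds to the generator. *)
Lemma mean_generator lamq muq mt (p f : state n -> R) :
  stationary lamq muq mt p -> mean p (generator lamq muq mt f) = 0.
Proof.
move=> [_ _ fin _ bal]; pose A := fset_set [set q | p q != 0].
have pA q : q \notin A -> p q = 0.
  by rewrite in_fset_set // => /negP; rewrite inE => /negP/negPn/eqP.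
(* This list holds the support of [p] and everything reached from it in one jump, so jump sums over
   [s] are complete. *)
pose s := undup (A ++ flatten [seq successors q | q <- A]).
have us : uniq s by rewrite undup_uniq.
have ss q : q \in A -> {subset successors q <= s}.
  move=> qA x xq; rewrite mem_undup mem_cat; apply/orP; right.
  by apply/flattenP; exists (successors q) => //; exact: map_f.
have sA (F : state n -> R) : (forall q, q \notin A -> F q = 0) ->
    \sum_(q <- s) F q = \sum_(q <- A) F q.
  move=> F0; rewrite (bigID (mem A)) /= addrC big1 => [|q /F0 //].
  rewrite add0r -big_filter; apply: perm_big; apply: uniq_perm.
  - exact: filter_uniq.
  - exact: fset_uniq.
  - by move=> x; rewrite mem_filter mem_undup mem_cat; case: (x \in A).
have tot : \sum_(q <- A) p q *
    (\sum_(q' <- s) jump_rate lamq muq mt q q' * f q') =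
  \sum_(q <- A) p q * ((\sum_j lamq q j + \sum_i muq q i) * f q).
  rewrite -[RHS]sA => [|q /pA ->]; last by rewrite mul0r.
  under eq_bigr => q _ do rewrite mulr_sumr.
  rewrite exchange_big /=; apply: eq_bigr => q' _.
  rewrite mulrA -bal (@fsbigTE _ _ _ _ A) => [|q /pA ->]; last by rewrite mul0r.
  by rewrite mulr_suml; apply: eq_bigr => q _; rewrite mulrA.
rewrite (mean_seq _ pA); move: tot.
rewrite (eq_big_seq (fun q => p q * generator lamq muq mt f q +
  p q * ((\sum_j lamq q j + \sum_i muq q i) * f q))) /=; last first.
  by move=> q /ss qs; rewrite jump_rate_sum // mulrDr.
by rewrite big_split /= => /(canRL (addrK _)) ->; rewrite subrr.
Qed.

(** The reachable set is closed under jumps of positive rate, so an invariant vector of the chain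
    restricted to it, extended by zero, is stationary for the full chain. *)
Lemma stationary_exists lamq muq mt :
  finite_set (reachable (jump_rate lamq muq mt)) ->
  (forall q q', reachable (jump_rate lamq muq mt) q ->
    0 <= jump_rate lamq muq mt q q') ->
  stationary lamq muq mt (stationary_dist lamq muq mt).
Proof.
set r := jump_rate _ _ _; move=> fin r0; apply: xgetPex.
pose A := fset_set (reachable r).
have inA q : (q \in A) <-> reachable r q.
  by rewrite in_fset_set // inE.
have A0 : empty_state n \in A by apply/inA; exact: reach_empty.
have out q q' : q \in A -> q' \notin A -> r q q' = 0.
  move=> /inA qA q'A; apply/eqP; rewrite -[_ == _]negbK; apply: contraNN q'A.
  move=> rqq; apply/inA; apply: (@reach_jump _ _ r q) => //.
  by rewrite lt_def rqq r0.
(* This is [jump_rate_sum] at the constant function 1, whose generator vanishes, once the null jumps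
   out of [A] are dropped. *)
have tot q : q \in A -> \sum_(q' <- A) r q q' = \sum_j lamq q j + \sum_i muq q i.
  move=> qA; pose s := undup (A ++ successors q).
  have := @jump_rate_sum lamq muq mt q s (fun=> 1) (undup_uniq _).
  rewrite mulr1 generator_cst add0r => <- => [|x xq]; last first.
    by rewrite mem_undup mem_cat xq orbT.
  rewrite [RHS](bigID (mem A)) /= [X in _ + X]big1 => [|q' q'A]; last first.
    by rewrite [jump_rate _ _ _ _ _](out _ _ qA q'A) mul0r.
  rewrite addr0 -[RHS]big_filter; under [RHS]eq_bigr => x _ do rewrite mulr1.
  apply: perm_big; apply: uniq_perm.
  - exact: fset_uniq.
  - exact/filter_uniq/undup_uniq.
  - by move=> x; rewrite mem_filter mem_undup mem_cat; case: (x \in A).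
have [v [v0 v1 vb]] := @invariant_vector_fin R A [` A0]%fset
  (fun x y => r (fsval x) (fsval y))
  (fun x y => r0 _ _ ((inA _).1 (fsvalP x))).
pose p q := if insub q is Some x then v x else 0.
have pE (x : A) : p (fsval x) = v x by rewrite /p valK.
have pA q : q \notin A -> p q = 0 by move=> qA; rewrite /p insubN.
have p0 q : 0 <= p q by rewrite /p; case: insub.
have pN0 q : p q != 0 -> reachable r q.
  by move=> pq; apply/inA; apply: contraNT pq => /pA ->.
exists p; split => //.
- by apply: sub_finite_set fin => q; exact: pN0.
- rewrite (@fsbigTE _ _ _ _ A) // big_seq_fsetE /= -v1.
  by apply: eq_bigr => x _; exact: pE.
- move=> q'; rewrite (@fsbigTE _ _ _ _ A) => [|q /pA ->]; last by rewrite mul0r.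
  have [q'A|q'A] := boolP (q' \in A); last first.
    rewrite (pA _ q'A) mul0r; apply: big1_seq => q /andP[_ qA].
    by rewrite [jump_rate _ _ _ _ _](out _ _ qA q'A) mulr0.
  rewrite -(tot _ q'A) !big_seq_fsetE /=.
  have := vb [` q'A]%fset; rewrite /= -(pE [` q'A]%fset) /= => <-.
  by apply: eq_bigr => x _; rewrite pE.
Qed.

End Jumps.

(** * Finite buffers and work-conserving matching *)

Definition greedy_dist (R : realType) (n : nat) (comp : 'I_n -> bool)
    (len : 'I_n -> nat) (p : 'I_n -> R) : Prop :=
  [/\ forall k, 0 <= p k,
      forall k, p k != 0 -> comp k && (0 < len k)%N
    & forall k, comp k -> (0 < len k)%N -> \sum_k p k = 1].

(** Work conservation, common to both matching rules. The relation [adj] is the compatibility graph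
    for max-weight, but the support of [chi] for randomized matching, which may be a smaller
    graph. *)
Definition greedy (R : realType) (n : nat) (adj : 'I_n -> 'I_n -> bool)
    (mt : matching R n) : Prop :=
  forall q : state n,
    (forall i, greedy_dist (adj i) (qc q) (match_s mt q i)) /\
    (forall j, greedy_dist (adj^~ j) (qs q) (match_c mt q j)).

Lemma greedy_distP (R : realType) (n : nat) (comp : 'I_n -> bool)
    (len : 'I_n -> nat) (p : 'I_n -> R) : greedy_dist comp len p ->
  (\sum_k p k = 1 /\ exists k, comp k /\ (0 < len k)%N) \/
  ((forall k, comp k -> len k = 0%N) /\ forall k, p k = 0).
Proof.
move=> [p0 pN0 p1].
have [/existsP[k /andP[ck lk]]|/existsPn H] :=
  boolP [exists k, comp k && (0 < len k)%N].
  by left; split; [exact: p1 ck lk | exists k].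
right; split => k => [ck|].
  by apply/eqP; move: (H k); rewrite ck /= lt0n negbK.
by apply/eqP; apply: contraNT (H k) => /pN0.
Qed.

(** Fluid price without the factor [eta], with an integer buffer. *)
Definition capped (R : realType) (n K : nat) (rate : 'I_n -> R)
    (len : state n -> 'I_n -> nat) : state n -> 'I_n -> R :=
  fun q k => rate k * (len q k < K)%N%:R.

(** Invariant of the reachable states: respected buffers, and no adjacent pair waiting at the same
    time. *)
Definition good (n K : nat) (adj : 'I_n -> 'I_n -> bool) (q : state n) : Prop :=
  [/\ forall j, (qc q j <= K)%N, forall i, (qs q i <= K)%N &
      forall i j, adj i j -> qc q j = 0%N \/ qs q i = 0%N].

(** * Stationary expectations of a greedy system with buffer [K] *)

Section Steady.
Variables (R : realType) (n : nat).
Implicit Types (lam mu : 'I_n -> R) (mt : matching R n) (K : nat)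
  (adj : 'I_n -> 'I_n -> bool).

Lemma good_finite K adj : finite_set (good K adj : set (state n)).
Proof.
pose T := ({ffun 'I_n -> 'I_K.+1} * {ffun 'I_n -> 'I_K.+1})%type.
pose emb (t : T) : state n := ([ffun j => val (t.1 j)], [ffun i => val (t.2 i)]).
apply: (@sub_finite_set _ _ (emb @` [set: T])) => [[a b] [/= aK bK _]|].
  exists ([ffun j => inord (a j)], [ffun i => inord (b i)]) => //.
  by congr (_, _); apply/ffunP => k; rewrite !ffunE /= inordK // ltnS;
    [exact: aK | exact: bK].
by apply: finite_image; exact: finite_finset.
Qed.

Lemma reachable_good K adj lam mu mt (q : state n) : greedy adj mt ->
  reachable (jump_rate (capped K lam (@qc n)) (capped K mu (@qs n)) mt) q ->
  good K adj q.
Proof.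
move=> gmt; elim => [|{}q q' _ [cK sK ex]].
  by split => [j|i|i j _]; rewrite /qc /qs ?ffunE //; left.
have cap (x : nat) (y : R) : y * (x < K)%N%:R != 0 -> (x < K)%N.
  by case: (x < K)%N; rewrite ?mulr0 ?eqxx.
have idle (p : 'I_n -> R) comp len : greedy_dist comp len p ->
    1 - \sum_k p k != 0 -> forall k, comp k -> len k = 0%N.
  by move=> /greedy_distP[[-> _]|[? _]] //; rewrite subrr eqxx.
rewrite lt_def /jump_rate => /andP[+ _].
set A := (X in X + _); set B := (X in _ + X) => AB.
have : A != 0 \/ B != 0.
  have [A0|] := eqVneq A 0; last by left.
  by right; move: AB; rewrite A0 add0r.
have leave (f : {ffun 'I_n -> nat}) k l : (leave_queue f k l <= f l)%N.
  by rewrite ffunE leq_subr.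
have join (f : {ffun 'I_n -> nat}) k l : (f l <= K)%N -> (f k < K)%N ->
    (join_queue f k l <= K)%N.
  by rewrite ffunE; case: eqP => [->|_]; rewrite ?addn1 ?addn0.
have leave0 (f : {ffun 'I_n -> nat}) k l : f l = 0%N -> leave_queue f k l = 0%N.
  by rewrite ffunE => ->.
have join0 (f : {ffun 'I_n -> nat}) k l : l != k -> f l = 0%N ->
    join_queue f k l = 0%N.
  by rewrite ffunE => /negbTE -> ->.
(* A match only shortens a queue. An agent that joins needs room in its own buffer ([lK]), and by
   [idle] finds all adjacent queues empty. *)
case => /mixture_neq0[[k ->]|[k [/cap lK ck ->]]];
  split => [j|i|i j ij]; rewrite /qc /qs /=.
- exact: cK.
- exact: leq_trans (leave _ _ _) (sK i).
- by have [|/leave0] := ex _ _ ij; [left|right].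
- exact: join (cK j) lK.
- exact: sK.
- have [jk|/join0 jk] := eqVneq j k.
    by right; move: ij; rewrite jk; exact: idle ((gmt q).2 k) ck i.
  by have [/jk|] := ex _ _ ij; [left|right].
- exact: leq_trans (leave _ _ _) (cK j).
- exact: sK.
- by have [/leave0|] := ex _ _ ij; [left|right].
- exact: cK.
- exact: join (sK i) lK.
- have [jk|/join0 jk] := eqVneq i k.
    by left; move: ij; rewrite jk; exact: idle ((gmt q).1 k) ck j.
  by have [|/jk] := ex _ _ ij; [left|right].
Qed.

Lemma greedy_dist_le1 comp len (p : 'I_n -> R) :
  greedy_dist comp len p -> \sum_k p k <= 1.
Proof.
by move=> /greedy_distP[[-> _]|[_ p0]] //; rewrite big1.
Qed.

Lemma jump_rate_ge0 (lamq muq : state n -> 'I_n -> R) adj mt (q q' : state n) :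
  (forall j, 0 <= lamq q j) -> (forall i, 0 <= muq q i) -> greedy adj mt ->
  0 <= jump_rate lamq muq mt q q'.
Proof.
move=> l0 m0 gmt; rewrite /jump_rate addr_ge0 //; apply: sumr_ge0 => k _;
  apply: mulr_ge0 => //; apply: addr_ge0.
- by apply: sumr_ge0 => i _; rewrite mulr_ge0 //; have [] := (gmt q).2 k.
- by rewrite mulr_ge0 // subr_ge0 (greedy_dist_le1 ((gmt q).2 k)).
- by apply: sumr_ge0 => i _; rewrite mulr_ge0 //; have [] := (gmt q).1 k.
- by rewrite mulr_ge0 // subr_ge0 (greedy_dist_le1 ((gmt q).1 k)).
Qed.

(* Stationarity is insensitive to the factor [eta] in the rates, so all
   estimates are made at the rates [lam], [mu] and are uniform in [eta]. *)
Record steady K adj lam mu mt (E : (state n -> R) -> R) : Prop := Steady {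
  steady_linear : forall (a : R) (f g : state n -> R),
    E (fun q => a * f q + g q) = a * E f + E g;
  steady_le : forall f g : state n -> R,
    (forall q, good K adj q -> f q <= g q) -> E f <= E g;
  steady_1 : E (fun=> 1) = 1;
  steady_generator : forall f : state n -> R,
    E (generator (capped K lam (@qc n)) (capped K mu (@qs n)) mt f) = 0 }.

Lemma mean_steady K adj lam mu mt (qmax : R) (m : nat) :
  (0 < m)%N -> (forall k : nat, (k%:R < qmax) = (k < K)%N) -> greedy adj mt ->
  (forall j, 0 <= lam j) -> (forall i, 0 <= mu i) ->
  steady K adj lam mu mt
    (mean (stationary_dist (fluid_price m qmax lam (@qc n))
                           (fluid_price m qmax mu (@qs n)) mt)).
Proof.
move=> m0 Kq gmt l0 u0.
have priceE (rate : 'I_n -> R) len :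
    fluid_price m qmax rate len = capped K (fun k => m%:R * rate k) len.
  by apply/funext => q; apply/funext => k; rewrite /fluid_price Kq.
rewrite !priceE; set lq := capped K _ _; set uq := capped K _ _.
set p := stationary_dist _ _ _.
have c0 (rate : 'I_n -> R) len q k : (forall k, 0 <= rate k) ->
    0 <= capped K (fun k => m%:R * rate k) len q k.
  by move=> r0; rewrite !mulr_ge0.
have gd q : reachable (jump_rate lq uq mt) q -> good K adj q.
  exact: reachable_good.
have st : stationary lq uq mt p.
  apply: stationary_exists => [|q q' _].
    exact: sub_finite_set gd (good_finite K adj).
  by apply: jump_rate_ge0 gmt => k; exact: c0.
have [p0 pr fin p1 _] := st.
pose A := fset_set [set q | p q != 0].
have pA q : q \notin A -> p q = 0.
  by rewrite in_fset_set // => /negP; rewrite inE => /negP/negPn/eqP.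
split => [a f g|f g fg||f].
- rewrite !(mean_seq _ pA) mulr_sumr -big_split; apply: eq_bigr => q _.
  by rewrite mulrDr mulrCA.
- rewrite !(mean_seq _ pA); apply: ler_sum => q _.
  have [->|pq] := eqVneq (p q) 0; first by rewrite !mul0r.
  by apply: ler_wpM2l => //; apply/fg/gd/pr.
- by rewrite -[RHS]p1; apply: eq_fsbigr => q _; rewrite /= mulr1.
- have /eqP : mean p (generator lq uq mt f) = 0 by exact: mean_generator.
  (* The generator is linear in the arrival rates, so the nonzero factor [m] can be cancelled. *)
  suff -> : generator lq uq mt f = fun q => m%:R *
      generator (capped K lam (@qc n)) (capped K mu (@qs n)) mt f q.
    rewrite !(mean_seq _ pA); under eq_bigr => q _ do rewrite mulrCA.
    by rewrite -mulr_sumr mulf_eq0 pnatr_eq0 eqn0Ngt m0 => /eqP.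
  apply/funext => q; rewrite /generator mulrDr !mulr_sumr.
  by congr (_ + _); apply: eq_bigr => k _; rewrite /lq /uq /capped !mulrA.
Qed.

Section SteadyTheory.
Variables (K : nat) (adj : 'I_n -> 'I_n -> bool) (lam mu : 'I_n -> R)
  (mt : matching R n) (E : (state n -> R) -> R).
Hypothesis Es : steady K adj lam mu mt E.

Lemma steady_eq (f g : state n -> R) :
  (forall q, good K adj q -> f q = g q) -> E f = E g.
Proof.
by move=> fg; apply/eqP; rewrite eq_le !(steady_le Es) // => q /fg ->.
Qed.

Lemma steady_0 : E (fun=> 0) = 0.
Proof.
by rewrite -[RHS](steady_generator Es (fun=> 0)); apply: steady_eq => q _;
  rewrite generator_cst.
Qed.

Lemma steadyZ (a : R) f : E (fun q => a * f q) = a * E f.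
Proof.
rewrite -[RHS]addr0 -steady_0 -(steady_linear Es).
by apply: steady_eq => q _; rewrite addr0.
Qed.

Lemma steadyD f g : E (fun q => f q + g q) = E f + E g.
Proof.
rewrite -[E f]mul1r -(steady_linear Es).
by apply: steady_eq => q _; rewrite mul1r.
Qed.

Lemma steadyB f g : E (fun q => f q - g q) = E f - E g.
Proof.
rewrite addrC -mulN1r -(steady_linear Es).
by apply: steady_eq => q _; rewrite mulN1r addrC.
Qed.

Lemma steady_cst (a : R) : E (fun=> a) = a.
Proof.
rewrite -[RHS]mulr1 -[X in _ = _ * X](steady_1 Es) -steadyZ.
by apply: steady_eq => q _; rewrite mulr1.
Qed.

Lemma steady_sum (F : 'I_n -> state n -> R) :
  E (fun q => \sum_k F k q) = \sum_k E (F k).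
Proof.
elim: (index_enum _) => [|k s IH].
  by rewrite big_nil -[RHS]steady_0; apply: steady_eq => q _; rewrite big_nil.
rewrite big_cons -IH -steadyD.
by apply: steady_eq => q _; rewrite big_cons.
Qed.

Lemma steady_ge0 f : (forall q, good K adj q -> 0 <= f q) -> 0 <= E f.
Proof. by move=> f0; rewrite -steady_0; exact: (steady_le Es). Qed.

(** The form in which every drift estimate is used: a pointwise bound [g] on the generator of a test
    function has nonnegative mean. *)
Lemma steady_generator_le f g :
  (forall q, good K adj q ->
    generator (capped K lam (@qc n)) (capped K mu (@qs n)) mt f q <= g q) ->
  0 <= E g.
Proof. by rewrite -(steady_generator Es f); exact: (steady_le Es). Qed.

End SteadyTheory.

Definition swap_state (q : state n) : state n := (q.2, q.1).

Definition swap_matching mt : matching R n :=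
  Matching (fun q => match_c mt (swap_state q))
           (fun q => match_s mt (swap_state q)).

(** Exchanging the two sides of the market turns an estimate on customer queues into one on server
    queues. *)
Lemma steady_swap K adj lam mu mt (E : (state n -> R) -> R) :
  steady K adj lam mu mt E ->
  steady K (fun i j => adj j i) mu lam (swap_matching mt)
    (fun f => E (f \o swap_state)).
Proof.
move=> Es; split => [a f g|f g fg||f].
- exact: (steady_linear Es).
- apply: (steady_le Es) => q [cK sK ex]; apply: fg; split => // i j ij.
  by have [] := ex _ _ ij; [right|left].
- exact: (steady_1 Es).
- rewrite -(steady_generator Es (f \o swap_state)).
  apply: (steady_eq Es) => -[a b] _.
  by rewrite /generator /= addrC.
Qed.

End Steady.

(** * Integer buffers and the decomposition of the profit loss *)

Lemma nat_cap (R : realType) (x : R) : 0 <= x ->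
  exists K : nat, [/\ forall k : nat, (k%:R < x) = (k < K)%N,
    x <= K%:R & K%:R < x + 1].
Proof.
move=> x0; have ex : exists k : nat, x <= k%:R.
  by exists (Num.bound x); rewrite ltW // archi_boundP.
case: (ex_minnP ex) => K xK min; exists K; split => // [k|].
  have [Kk|kK] := leqP K k.
    by apply/negbTE; rewrite -leNgt (le_trans xK) // ler_nat.
  by rewrite ltNge; apply: contraTN kK => /min; rewrite -leqNgt.
case: K {xK} min => [_|K min]; first by rewrite ltr_wpDl.
rewrite -natr1 ltrD2r ltNge; apply/negP => /min; by rewrite ltnn.
Qed.

Section Loss.
Variables (R : realType) (n : nat).
Implicit Types (M : market R n) (lam mu : 'I_n -> R) (mt : matching R n).

Lemma fluid_value_optimal M lam mu chi :
  fluid_optimal M lam mu chi -> fluid_value M = fluid_profit M lam mu.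
Proof.
move=> [fe opt]; apply/eqP; rewrite eq_le; apply/andP; split.
  apply: ge_sup => [|_ [l [u [c [fe' ->]]]]]; last exact: opt fe'.
  by exists (fluid_profit M lam mu), lam, mu, chi.
apply: ub_le_sup; last by exists lam, mu, chi.
by exists (fluid_profit M lam mu) => _ [l [u [c [fe' ->]]]]; exact: opt fe'.
Qed.

(** A type trades either at its nominal rate or, when its queue is full, not at all. The loss is
    therefore the revenue lost to blocked customers, minus the payments saved on blocked servers,
    plus the waiting costs. *)
Lemma fluid_loss_steady M lam mu chi mt adj (K m : nat) (qmax : R) :
  fluid_optimal M lam mu chi -> (forall j, 0 <= lam j) ->
  (forall i, 0 <= mu i) -> greedy adj mt -> (0 < m)%N ->
  (forall k : nat, (k%:R < qmax) = (k < K)%N) ->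
  exists2 E, steady K adj lam mu mt E &
    fluid_loss M lam mu mt qmax m =
    m%:R * (\sum_j lam j * demand M j (lam j) *
              E (fun q => (K <= qc q j)%N%:R) -
            \sum_i mu i * supply M i (mu i) *
              E (fun q => (K <= qs q i)%N%:R)) +
    (\sum_j cost_c M j * E (fun q => (qc q j)%:R) +
     \sum_i cost_s M i * E (fun q => (qs q i)%:R)).
Proof.
move=> opt l0 u0 gmt m0 Kq; have Es := mean_steady m0 Kq gmt l0 u0.
exists (mean (stationary_dist (fluid_price m qmax lam (@qc n))
                              (fluid_price m qmax mu (@qs n)) mt)) => //.
rewrite /fluid_loss /profit_loss (fluid_value_optimal opt).
set E := mean _ in Es *.
have mN0 : m%:R != 0 :> R by rewrite pnatr_eq0 -lt0n.
have rev (rate : 'I_n -> R) len (F : 'I_n -> R -> R) q k :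
    fluid_price m qmax rate len q k *
      F k (fluid_price m qmax rate len q k / m%:R) =
    m%:R * (rate k * F k (rate k)) -
    m%:R * (rate k * F k (rate k)) * (K <= len q k)%N%:R.
  rewrite /fluid_price Kq [(K <= _)%N]leqNgt; case: (_ < K)%N => /=.
    by rewrite mulr1n mulr0n mulr1 mulr0 subr0 mulrA [_ / _]mulrC mulKf.
  by rewrite mulr0n mulr1n mulr0 mul0r mulr1 subrr.
have -> : E (fun q =>
    \sum_j fluid_price m qmax lam (@qc n) q j *
      demand M j (fluid_price m qmax lam (@qc n) q j / m%:R) -
    \sum_i fluid_price m qmax mu (@qs n) q i *
      supply M i (fluid_price m qmax mu (@qs n) q i / m%:R)) =
  \sum_j (m%:R * (lam j * demand M j (lam j)) -
    m%:R * (lam j * demand M j (lam j)) * E (fun q => (K <= qc q j)%N%:R)) -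
  \sum_i (m%:R * (mu i * supply M i (mu i)) -
    m%:R * (mu i * supply M i (mu i)) * E (fun q => (K <= qs q i)%N%:R)).
  rewrite (steadyB Es) !(steady_sum Es).
  by congr (_ - _); apply: eq_bigr => k _;
    rewrite -(steadyZ Es) -[X in X - _](steady_cst Es) -(steadyB Es);
    apply: (steady_eq Es) => q _; exact: rev.
have split (c e : 'I_n -> R) : \sum_k (m%:R * c k - m%:R * c k * e k) =
    m%:R * (\sum_k c k - \sum_k c k * e k).
  by rewrite -sumrB mulr_sumr; apply: eq_bigr => k _; rewrite mulrBr mulrA.
rewrite !split /fluid_profit; ring.
Qed.

End Loss.

(** * Randomized matching *)

Lemma randomized_greedy (R : realType) (n : nat) (chi : 'I_n -> 'I_n -> R) :
  (forall i j, 0 <= chi i j) ->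
  greedy (fun i j => chi i j != 0) (randomized chi).
Proof.
move=> chi0 q.
have G (w : 'I_n -> R) (len : 'I_n -> nat) : (forall k, 0 <= w k) ->
    greedy_dist (fun k => w k != 0) len
      (fun k => w k * (0 < len k)%N%:R / \sum_l w l * (0 < len l)%N%:R).
  move=> w0; have w1 k : 0 <= w k * (0 < len k)%N%:R by rewrite mulr_ge0.
  split => [k|k|k wk lk].
  - by rewrite divr_ge0 // sumr_ge0.
  - by rewrite !mulf_eq0 !negb_or pnatr_eq0 eqb0 negbK => /andP[].
  - rewrite -mulr_suml divff // gt_eqF // (bigD1 k) //= lk mulr1.
    by rewrite ltr_wpDr ?sumr_ge0 // lt_def wk w0.
by split => [i|j]; exact: G.
Qed.

(** The test function [x (x + 1)] of the queue length [x] grows by [2 (x + 1)] at an arrival and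
    drops by [2 x] at a service. Arrivals at rate at most [lam j] below [K] against service at rate
    at least [lam j] leave a drift of at most [2 lam j], and of [- 2 K lam j] when the queue is
    full. *)
Lemma randomized_blocking (R : realType) (n K : nat) (lam mu : 'I_n -> R)
    (chi : 'I_n -> 'I_n -> R) E (j : 'I_n) :
  (forall i j, 0 <= chi i j) -> (forall j, lam j = \sum_i chi i j) ->
  (forall i, mu i = \sum_j chi i j) -> (0 < K)%N -> 0 < lam j ->
  steady K (fun i j => chi i j != 0) lam mu (randomized chi) E ->
  K.+1%:R * E (fun q => (K <= qc q j)%N%:R) <= 1.
Proof.
move=> chi0 lamE muE K0 lj Es.
pose f (q : state n) : R := (qc q j)%:R * (qc q j)%:R + (qc q j)%:R.
have gr := randomized_greedy chi0.
have : 0 <= E (fun q => 2 * lam j * (1 - K.+1%:R * (K <= qc q j)%N%:R)).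
  apply: (steady_generator_le Es (f := f)) => q gq; have [cK sK ex] := gq.
  rewrite /generator; set x := qc q j.
  apply: (@le_trans _ _ (lam j * (x < K)%N%:R * (2 * (x%:R + 1)) -
                         2 * x%:R * lam j)).
    apply: lerD.
      rewrite (bigD1 j) //= [X in _ + X]big1 => [|k kj]; last first.
        rewrite /arrival big1 => [|i _]; last by rewrite /f /qc subrr mulr0.
        by rewrite /f /qc /= !ffunE eq_sym (negbTE kj) addn0 subrr mulr0 addr0 mulr0.
      rewrite addr0; apply: ler_wpM2l; first by rewrite mulr_ge0 // ltW.
      rewrite /arrival big1 => [|i _]; last by rewrite /f /qc subrr mulr0.
      rewrite add0r /f /qc /= !ffunE eqxx -/x natrD.
      have -> : (x%:R + 1%:R) * (x%:R + 1%:R) + (x%:R + 1%:R) -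
        (x%:R * x%:R + x%:R) = 2 * (x%:R + 1) :> R by ring.
      rewrite ler_piMl ?mulr_ge0 ?addr_ge0 // gerBl sumr_ge0 // => i _.
      by case: ((gr q).2 j) => p0 _ _; exact: p0.
    rewrite lamE mulrC mulr_suml -sumrN; apply: ler_sum => i _.
    rewrite /arrival [X in X + _](bigD1 j) //= [X in _ + X + _]big1 => [|k kj]; last first.
      by rewrite /f /qc /= !ffunE eq_sym (negbTE kj) subn0 subrr mulr0.
    rewrite /f /qc /= subrr mulr0 !addr0 !ffunE eqxx -/x.
    have -> : ((x - 1)%N%:R * (x - 1)%N%:R + (x - 1)%N%:R -
        (x%:R * x%:R + x%:R)) = - (2 * x%:R) :> R.
      case: (x) => [|y]; first by rewrite sub0n; ring.
      by rewrite subSS subn0 -natr1; ring.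
    have [x0|x0] := posnP x; first by rewrite x0 !mulr0 oppr0 !mulr0.
    rewrite !mulrN lerN2 [X in _ <= X]mulrA; apply: ler_wpM2r.
      by rewrite mulr_ge0.
    have [->|cij] := eqVneq (chi i j) 0.
      by rewrite !mul0r mulr0.
    have [/eqP|si] := ex i j cij; first by rewrite -/x gtn_eqF.
    (* Server type [i] has an empty queue, hence is not blocked. It serves [j] at rate
       [mu i * chi i j / d], which is at least [chi i j] because [d <= mu i]. *)
    rewrite /capped si K0 /= -/(qc q) !mulr1.
    set d := \sum_j' _.
    have d0 : 0 < d.
      rewrite /d (bigD1 j) //= -/(qc q j) -/x x0 mulr1 ltr_wpDr ?sumr_ge0 //.
        by move=> k _; rewrite mulr_ge0.
      by rewrite lt_def cij chi0.
    rewrite mulrCA ler_peMr // ler_pdivlMr // mul1r muE.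
    by apply: ler_sum => k _; rewrite ler_piMr // lern1 leq_b1.
  have xK := cK j; rewrite -/x in xK.
  case: (ltngtP x K) xK => // [xK|->] _ /=.
    by rewrite le_eqVlt; apply/orP; left; apply/eqP; ring.
  by rewrite -natr1 le_eqVlt; apply/orP; left; apply/eqP; ring.
rewrite (steadyZ Es) pmulr_rge0 ?mulr_gt0 // (steadyB Es) (steady_cst Es).
by rewrite (steadyZ Es) subr_ge0.
Qed.

Lemma bigO_seq_le (R : realType) (f g : nat -> R) (C : R) :
  (forall m, (0 < m)%N -> `|f m| <= C * `|g m|) -> f =O_\oo g.
Proof.
move=> fg; apply/eqO_exP; exists (Num.max C 1); first by rewrite lt_max ltr01 orbT.
exists 1%N => // m /= m0; apply: le_trans (fg _ m0) _.
by apply: ler_wpM2r => //; rewrite le_max lexx.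
Qed.

Lemma sum_mul_ge0 (R : numDomainType) (n : nat) (a b : 'I_n -> R) :
  (forall k, 0 <= a k) -> (forall k, 0 <= b k) -> 0 <= \sum_k a k * b k.
Proof. by move=> a0 b0; apply: sumr_ge0 => k _; rewrite mulr_ge0. Qed.

Lemma sum_mul_le (R : numDomainType) (n : nat) (a b : 'I_n -> R) (c : R) :
  (forall k, 0 <= a k) -> (forall k, b k <= c) ->
  \sum_k a k * b k <= (\sum_k a k) * c.
Proof.
by move=> a0 bc; rewrite mulr_suml; apply: ler_sum => k _; rewrite ler_wpM2l.
Qed.

Lemma fluid_setting_ge0 (R : realType) (n : nat) (M : market R n) lam mu chi :
  fluid_setting M lam mu chi ->
  [/\ forall j, 0 <= demand M j (lam j), forall i, 0 <= supply M i (mu i),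
      forall j, 0 <= cost_c M j, forall i, 0 <= cost_s M i
    & forall i j, 0 <= chi i j].
Proof.
move=> [[dem sup cc cs] _ [[[Dl Du] _ _ chi0 chiN] _] _ _].
split=> [j|i|j|i|i j].
- by have [_ [F0 _ _ _]] := dem j; exact: F0.
- by have [_ [G0 _ _ _]] := sup i; exact: G0.
- exact: ltW.
- exact: ltW.
- by have [/chi0|/chiN ->] := boolP (compat M i j).
Qed.

Lemma randomized_loss (R : realType) (n : nat) (M : market R n)
    (lam mu : 'I_n -> R) (chi : 'I_n -> 'I_n -> R) (gamma : R) :
  0 < gamma -> fluid_setting M lam mu chi ->
  (fun eta : nat => fluid_loss M lam mu (randomized chi)
                      (gamma * Num.sqrt eta%:R) eta)
    =O_\oo (fun eta : nat => Num.sqrt (eta%:R : R)).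
Proof.
move=> g0 st; have [F0 G0 cc0 cs0 chi0] := fluid_setting_ge0 st.
have [_ _ opt l0 u0] := st; have [[_ lamE muE _ _] _] := opt.
pose D := \sum_j lam j * demand M j (lam j).
pose S := \sum_i mu i * supply M i (mu i).
pose H := \sum_j cost_c M j + \sum_i cost_s M i.
have D0 : 0 <= D by apply: sum_mul_ge0 => // j; exact: ltW.
have S0 : 0 <= S by apply: sum_mul_ge0 => // j; exact: ltW.
have H0 : 0 <= H by rewrite addr_ge0 ?sumr_ge0.
(* Blocking costs at most [m / (gamma r)], that is [r / gamma], per unit of [D + S], where [r] is
   the root of [m]. Queues are at most [K < gamma r + 1 <= (gamma + 1) r]. *)
apply: (@bigO_seq_le _ _ _ ((D + S) / gamma + H * (gamma + 1))) => m m0.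
set r := Num.sqrt m%:R; have r1 : 1 <= r.
  by rewrite -(@sqrtr1 R) ler_sqrt // ler1n.
have r0 : 0 < r by exact: lt_le_trans r1.
have rr : r * r = m%:R by rewrite -expr2 sqr_sqrtr.
have q0 : 0 < gamma * r by rewrite mulr_gt0.
have [K [Kq qK Kq1]] := nat_cap (ltW q0).
have K0 : (0 < K)%N by rewrite -Kq.
have [E Es ->] := fluid_loss_steady opt (fun j => ltW (l0 j))
  (fun i => ltW (u0 i)) (randomized_greedy chi0) m0 Kq.
have blk x : K.+1%:R * x <= 1 -> x <= (gamma * r)^-1.
  have [x0 _|x0 Kx] := lerP x 0.
    by rewrite (le_trans x0) // invr_ge0 ltW.
  rewrite -[leRHS]div1r ler_pdivlMr //; apply: le_trans Kx.
  rewrite mulrC ler_pM2r // (le_trans qK) // ler_nat //.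
have ind0 (b : state n -> bool) : 0 <= E (fun q => (b q)%:R).
  by apply: (steady_ge0 Es) => q _.
have bc j : E (fun q => (K <= qc q j)%N%:R) <= (gamma * r)^-1.
  by apply/blk/(randomized_blocking _ _ _ _ _ Es).
(* The server side is the customer side of the swapped system. *)
have bs i : E (fun q => (K <= qs q i)%N%:R) <= (gamma * r)^-1.
  by apply/blk/(randomized_blocking _ _ _ _ _ (steady_swap Es)) => // ? ?.
have len (h : state n -> nat) : (forall q, good K (fun i j => chi i j != 0) q ->
    (h q <= K)%N) -> E (fun q => (h q)%:R) <= (gamma + 1) * r.
  move=> hK; apply: (@le_trans _ _ K%:R).
    rewrite -[leRHS](steady_cst Es); apply: (steady_le Es) => q /hK.
    by rewrite ler_nat.
  by rewrite mulrDl mul1r (le_trans (ltW Kq1)) // lerD2l.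
have len0 (h : state n -> nat) : 0 <= E (fun q => (h q)%:R).
  by apply: (steady_ge0 Es) => q _.
set X := \sum_j lam j * _ * _; set Y := \sum_i mu i * _ * _.
set Z := \sum_j _ * _ + _.
have X0 : 0 <= X by apply: sum_mul_ge0 => // j; rewrite mulr_ge0 // ltW.
have Y0 : 0 <= Y by apply: sum_mul_ge0 => // j; rewrite mulr_ge0 // ltW.
have Z0 : 0 <= Z by rewrite addr_ge0 ?sum_mul_ge0.
have XD : X <= D * (gamma * r)^-1.
  by apply: sum_mul_le => // j; rewrite mulr_ge0 // ltW.
have YS : Y <= S * (gamma * r)^-1.
  by apply: sum_mul_le => // j; rewrite mulr_ge0 // ltW.
have ZH : Z <= H * ((gamma + 1) * r).
  rewrite mulrDl; apply: lerD; apply: sum_mul_le => // k; apply: len => q;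
  by case.
have mr : m%:R * (gamma * r)^-1 = r / gamma.
  by rewrite -rr invfM mulrACA [r / r]divff ?gt_eqF // mulr1 mulrC.
have mX : m%:R * X <= D * (r / gamma).
  by rewrite -mr mulrCA ler_wpM2l.
have mY : m%:R * Y <= S * (r / gamma).
  by rewrite -mr mulrCA ler_wpM2l.
have mX0 : 0 <= m%:R * X by rewrite mulr_ge0.
have mY0 : 0 <= m%:R * Y by rewrite mulr_ge0.
have e1 : 0 <= D * (r / gamma) by exact: le_trans mX.
have e2 : 0 <= S * (r / gamma) by exact: le_trans mY.
rewrite (gtr0_norm r0) mulrBr ler_norml.
have -> : ((D + S) / gamma + H * (gamma + 1)) * r =
    D * (r / gamma) + S * (r / gamma) + H * ((gamma + 1) * r) by ring.
by apply/andP; split; lra.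
Qed.

Lemma max_weight_bound_bigO (R : realType) (M : forall n, market R n)
    (lam mu : forall n, 'I_n -> R) (chi : forall n, 'I_n -> 'I_n -> R) (C : R) :
  (forall n, (0 < n)%N ->
     fluid_setting (M n) (lam n) (mu n) (chi n) /\
     data_le (M n) (lam n) (mu n) C) ->
  (fun n : nat => max_weight_bound (M n) (lam n) (mu n))
    =O_\oo (fun n : nat => Num.sqrt (n%:R : R)).
Proof.
(* The two rate sums total at most [2 n C], so the averaged rate is at most [C], as is each of the
   maxima. *)
move=> H; apply: (@bigO_seq_le _ _ _ (C * C + 2 * C)) => n n0.
have [st [dc ds]] := H n n0; have [F0 _ cc0 cs0 _] := fluid_setting_ge0 st.
have [_ _ _ l0 u0] := st.
have C0 : 0 <= C.
  by have [lC _ _] := dc (Ordinal n0); rewrite (le_trans _ lC) // ltW.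
have sC (f : 'I_n -> R) : (forall k, f k <= C) -> \sum_k f k <= n%:R * C.
  move=> fC; apply: (@le_trans _ _ (\sum_(k < n) C)); first exact: ler_sum.
  by rewrite sumr_const card_ord mulr_natl.
rewrite /max_weight_bound normrM mulrC ler_wpM2r //.
set F := \big[Num.max/0]_j _; set cs := \big[Num.max/0]_i _.
set cc := \big[Num.max/0]_j cost_c _ _.
have F01 : 0 <= F <= C.
  by rewrite bigmax_ge_id bigmax_le // => j _; case: (dc j).
have cs01 : 0 <= cs <= C.
  by rewrite bigmax_ge_id bigmax_le // => j _; case: (ds j).
have cc01 : 0 <= cc <= C.
  by rewrite bigmax_ge_id bigmax_le // => j _; case: (dc j).
have c1 : 0 <= Num.max cs cc <= C.
  by rewrite le_max ge_max; case/andP: cs01 => -> ->; case/andP: cc01 => _ ->.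
have l1 : 0 <= (\sum_j lam n j + \sum_i mu n i) / (2 * n%:R) <= C.
  rewrite divr_ge0 ?addr_ge0 //=; try by apply: sumr_ge0 => k _; exact: ltW.
  rewrite ler_pdivrMr ?mulr_gt0 ?ltr0n // mulrCA mulr_natl mulr2n.
  by rewrite [C * _]mulrC lerD // sC // => k; [case: (dc k)|case: (ds k)].
case/andP: l1 => l1 lC; case/andP: F01 => F1 FC; case/andP: c1 => c1 cC.
rewrite ger0_norm; last by rewrite addr_ge0 //; exact: mulr_ge0.
by rewrite lerD // ?ler_wpM2l // ler_pM.
Qed.

(** * A linear lower bound *)

(** Meant for functions that cannot tell a match from a joining agent, such as differences of queue
    lengths: the mixture then collapses. *)
Lemma arrival_cst (R : realType) (n : nat) (m : 'I_n -> R)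
    (own other : {ffun 'I_n -> nat}) (k : 'I_n)
    (f : {ffun 'I_n -> nat} -> {ffun 'I_n -> nat} -> R) (d : R) :
  (forall i, m i != 0 -> f own (leave_queue other i) - f own other = d) ->
  (1 - \sum_i m i != 0 -> f (join_queue own k) other - f own other = d) ->
  arrival m own other k f = d.
Proof.
move=> fl fj; rewrite /arrival.
have -> : \sum_i m i * (f own (leave_queue other i) - f own other) =
    (\sum_i m i) * d.
  rewrite mulr_suml; apply: eq_bigr => i _.
  by have [->|/fl ->//] := eqVneq (m i) 0; rewrite !mul0r.
have -> : (1 - \sum_i m i) * (f (join_queue own k) other - f own other) =
    (1 - \sum_i m i) * d.
  by have [->|/fj ->//] := eqVneq (1 - \sum_i m i) 0; rewrite !mul0r.
ring.
Qed.

(** * An affine market whose fluid solution is supported on the diagonal *)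

Section Example.
Variable R : realType.

Lemma is_derive_quadratic (a b c x : R) :
  is_derive x 1 (fun y => a + b * y + c * (y * y)) (b + 2 * c * x).
Proof.
have h1 : is_derive x 1 (fun y : R => y) 1 by exact: is_derive_id.
apply: is_derive_eq; rewrite /GRing.scale /=; ring.
Qed.

(** The derivative is written as a quadratic with null leading coefficient, so that the lemma can be
    applied to its own result. *)
Lemma derive1_quadratic (a b c : R) :
  derive1 (fun y => a + b * y + c * (y * y)) = fun x => b + 2 * c * x + 0 * (x * x).
Proof.
apply/funext => x; rewrite derive1E (@derive_val _ _ _ _ _ _ _ (is_derive_quadratic a b c x)).
by rewrite mul0r addr0.
Qed.

Lemma derivable_quadratic (a b c x : R) :
  derivable (fun y => a + b * y + c * (y * y)) x 1.
Proof. by have [] := is_derive_quadratic a b c x. Qed.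

Lemma derive12_quadratic (a b c : R) :
  derive1n 2 (fun y => a + b * y + c * (y * y)) = fun=> 2 * c.
Proof.
rewrite /derive1n /= !derive1_quadratic; apply/funext => x; ring.
Qed.

Lemma C2_affine (a b x : R) : C2_at (fun y => a + b * y) x.
Proof.
have -> : (fun y => a + b * y) = (fun y => a + b * y + 0 * (y * y)).
  by apply/funext => y; rewrite mul0r addr0.
split.
  near=> y; rewrite derive1_quadratic; split; exact: derivable_quadratic.
rewrite derive12_quadratic; exact: cst_continuous.
Unshelve. all: by end_near. Qed.

(** At a common rate [x] a pair of types earns [3 x - 3 x^2 / 2], maximal at [x = 1], where the
    margin of price over supply cost is [3 / 2]. The complete graph yields resource pooling even
    though the diagonal [chi] never uses the other edges. *)
Definition affine_market (n : nat) : market R n :=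
  {| compat := fun _ _ => true;
     demand := fun _ x => 3 - x;
     supply := fun _ x => x / 2;
     demand_range := fun _ => [set x | 0 <= x <= 2];
     supply_range := fun _ => [set x | 0 <= x <= 2];
     cost_c := fun=> 1;
     cost_s := fun=> 1 |}.

Definition diagonal (n : nat) : 'I_n -> 'I_n -> R := fun i j => (i == j)%:R.

Lemma affine_market_valid (n : nat) : valid_market (affine_market n).
Proof.
have rg : rate_range [set x : R | 0 <= x <= 2].
  split => [x y /andP[x0 _] /andP[_ y2] z /andP[xz zy]||x /andP[]//].
    by rewrite /= (le_trans x0) // (le_trans zy).
  by rewrite /= lexx ler0n.
split => [j|i|j|i] //=; (split; first exact: rg); split => //=.
- by move=> x /andP[x0 x2]; lra.
- by move=> x y _ _ xy; lra.
- move=> x _; have -> : (fun x : R => 3 - x) = fun x => 3 + (-1) * x.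
    by apply/funext => y; ring.
  exact: C2_affine.
- move=> x _; have -> : (fun l : R => l * (3 - l)) =
      (fun y => 0 + 3 * y + (-1) * (y * y)).
    by apply/funext => y; ring.
  by rewrite !derive1_quadratic; lra.
- by move=> x /andP[x0 x2]; lra.
- by move=> x y _ _ xy; lra.
- move=> x _; have -> : (fun x : R => x / 2) = fun x => 0 + 2^-1 * x.
    by apply/funext => y; ring.
  exact: C2_affine.
- move=> x _; have -> : (fun l : R => l * (l / 2)) =
      (fun y => 0 + 0 * y + 2^-1 * (y * y)).
    by apply/funext => y; ring.
  by rewrite !derive1_quadratic; lra.
Qed.

Lemma affine_market_setting (n : nat) :
  fluid_setting (affine_market n) (fun=> 1) (fun=> 1) (@diagonal n).
Proof.
split => //; first exact: affine_market_valid.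
  by exists id => //; exists id.
split; first split => //=.
- by split => _; rewrite ler01 ler1n.
- move=> j; rewrite (bigD1 j) //= /diagonal eqxx big1 ?addr0 // => i ij.
  by rewrite (negbTE ij).
- move=> i; rewrite (bigD1 i) //= /diagonal eqxx big1 ?addr0 // => j ij.
  by rewrite eq_sym (negbTE ij).
- move=> l u c [_ lE uE _ _]; rewrite /fluid_profit /=.
  have lu : \sum_j l j = \sum_i u i.
    rewrite (eq_bigr _ (fun j _ => lE j)) exchange_big /=.
    by apply: eq_bigr => i _; rewrite uE.
  (* Lagrangian bound with multiplier 1 for the equality of the total rates: it separates into
     [2 l - l^2 <= 1] and [u - u^2 / 2 <= 1 / 2]. *)
  rewrite -!sumrB; apply: (@le_trans _ _ (\sum_(k < n) (1 * (3 - 1) - 1 * (1 / 2) + (l k - u k)))).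
    apply: ler_sum => k _.
    have := sqr_ge0 (l k - 1); have := sqr_ge0 (u k - 1); rewrite !expr2; nra.
  by rewrite big_split /= [X in _ + X]sumrB lu subrr addr0.
Qed.

Lemma affine_market_pooling (n : nat) :
  pooling (affine_market n) (fun=> 1) (fun=> 1).
Proof.
have P (J : {set 'I_n}) : J != finset.set0 -> J != finset.setT ->
    \sum_(j in J) (1 : R) < \sum_(i : 'I_n | [exists j in J, true]) 1.
  move=> /set0Pn[j jJ] JT.
  have -> : \sum_(i : 'I_n | [exists j in J, true]) 1 =
      \sum_(i in [set: 'I_n]%SET) (1 : R).
    apply: eq_bigl => i; rewrite finset.in_setT.
    by apply: (introT existsP); exists j; rewrite jJ.
  rewrite !sumr_const ltr_nat; apply: proper_card.
  by rewrite finset.properEneq JT finset.subsetT.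
by split => J J0 JT; exact: P.
Qed.

Lemma diagonal_arrival (n : nat) (m : 'I_n -> R) (own other : {ffun 'I_n -> nat})
    (k l : 'I_n) (h : R -> R) :
  greedy_dist (fun i => i == k) other m ->
  arrival m own other k (fun a b => h ((a l)%:R - (b l)%:R)) =
  (k == l)%:R * (h ((own l)%:R - (other l)%:R + 1) - h ((own l)%:R - (other l)%:R)).
Proof.
move=> [_ mN0 _]; apply: arrival_cst => [i /mN0 /andP[/eqP -> ok]|_].
  rewrite !ffunE eq_sym; case: eqP => [kl|_] /=; last by rewrite subn0 subrr mul0r.
  by rewrite mul1r -kl natrB //; congr (h _ - _); ring.
rewrite !ffunE eq_sym; case: eqP => [kl|_] /=; last by rewrite addn0 subrr mul0r.
by rewrite mul1r natrD; congr (h _ - _); ring.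
Qed.

(** The difference of the two queues equals [K] when customers are blocked and [-K] when servers
    are. The drift of its square is thus exactly 2 minus [2 K + 1] times the sum of the two blocking
    indicators, and the drift of the difference itself makes their means equal. *)
Lemma diagonal_blocking (n K : nat) E (i : 'I_n) : (0 < K)%N ->
  steady K (fun i j => i == j) (fun=> 1) (fun=> 1) (randomized (@diagonal n)) E ->
  E (fun q => (K <= qc q i)%N%:R) = (2 * K%:R + 1)^-1 /\
  E (fun q => (K <= qs q i)%N%:R) = (2 * K%:R + 1)^-1.
Proof.
move=> K0 Es.
have gr : greedy (fun i j => i == j) (randomized (@diagonal n)).
  move=> q; have [] := @randomized_greedy R n (@diagonal n) (fun _ _ => ler0n _ _) q.
  have dE (a b : 'I_n) : (@diagonal n a b != 0) = (a == b).
    by rewrite /diagonal pnatr_eq0 eqb0 negbK.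
  by move=> gs gc; split => a; [move: (gs a)|move: (gc a)];
    move=> [p0 pN0 p1]; split=> // k; rewrite -dE; [exact: pN0|exact: p1|exact: pN0|exact: p1].
have gen (h : R -> R) (q : state n) :
    generator (capped K (fun=> 1) (@qc n)) (capped K (fun=> 1) (@qs n))
      (randomized (@diagonal n)) (fun q => h ((qc q i)%:R - (qs q i)%:R)) q =
    (1 - (K <= qc q i)%N%:R) * (h ((qc q i)%:R - (qs q i)%:R + 1) -
                          h ((qc q i)%:R - (qs q i)%:R)) +
    (1 - (K <= qs q i)%N%:R) * (h ((qc q i)%:R - (qs q i)%:R - 1) -
                          h ((qc q i)%:R - (qs q i)%:R)).
  have one (w : 'I_n -> nat) (x : R) :
      \sum_j 1 * (w j < K)%N%:R * ((j == i)%:R * x) = (1 - (K <= w i)%N%:R) * x.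
    rewrite (bigD1 i) //= eqxx big1 => [|j ji]; last first.
      by rewrite (negbTE ji) mul0r mulr0.
    by rewrite addr0 !mul1r [(K <= _)%N]leqNgt; case: (_ < K)%N; congr (_ * _); rewrite /=; ring.
  rewrite /generator -!one; congr (_ + _); apply: eq_bigr => k _;
    congr (_ * _).
    by apply: (@diagonal_arrival n _ q.1 q.2 k i h); exact: (gr q).2.
  (* Reflecting [h] makes the statement on customer arrivals apply to server arrivals. *)
  have -> : (fun a b : {ffun 'I_n -> nat} => h ((qc (b, a) i)%:R - (qs (b, a) i)%:R)) =
      (fun a b => (h \o -%R) ((a i)%:R - (b i)%:R)).
    by apply/funext => a; apply/funext => b; rewrite /= opprB.
  rewrite (@diagonal_arrival n _ q.2 q.1 k i) /=; last first.
    by have [p0 pN0 p1] := (gr q).1 k; split=> // l; rewrite [l == k]eq_sym; [exact: pN0|exact: p1].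
  by rewrite opprD !opprB.
have z1 : E (fun q => (K <= qs q i)%N%:R) = E (fun q => (K <= qc q i)%N%:R).
  apply/eqP; rewrite -subr_eq0 -(steadyB Es).
  rewrite -(steady_generator Es (fun q => (qc q i)%:R - (qs q i)%:R)).
  by apply/eqP/(steady_eq Es) => q _; rewrite (gen id) /=; ring.
have z2 : E (fun q => 2 - (2 * K%:R + 1) *
    ((K <= qc q i)%N%:R + (K <= qs q i)%N%:R)) = 0.
  rewrite -(steady_generator Es (fun q =>
    ((qc q i)%:R - (qs q i)%:R) * ((qc q i)%:R - (qs q i)%:R))).
  apply: (steady_eq Es) => q [cK sK ex]; rewrite (gen (fun x => x * x)).
  move: (cK i) (sK i) (ex i i (eqxx i)).
  case: (ltngtP (qc q i) K) => // [cK' _|-> _];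
  case: (ltngtP (qs q i) K) => // [sK' _|-> _].
  - by rewrite /= => _; ring.
  - by case=> [->|KK]; [rewrite /=; ring | rewrite KK in K0].
  - by case=> [KK|->]; [rewrite KK in K0 | rewrite /=; ring].
  - by case=> KK; rewrite KK in K0.
move: z2; rewrite (steadyB Es) (steady_cst Es) (steadyZ Es) (steadyD Es) z1.
set x := E _ => z2; have k0 : 0 < 2 * K%:R + 1 :> R by rewrite ltr_wpDl ?mulr_ge0.
have kN : 2 * K%:R + 1 != 0 :> R by rewrite gt_eqF.
suff -> : x = (2 * K%:R + 1)^-1 by [].
by apply: (mulfI kN); rewrite divff //; lra.
Qed.

End Example.

(** * Eventual bounds and the loss of the affine example *)

Lemma limn_esup_le_near (R : realType) (u : (\bar R)^nat) (l : \bar R) :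
  (\forall m \near \oo, (u m <= l)%E) -> (limn_esup u <= l)%E.
Proof.
move=> ul; rewrite /limn_esup limf_esupE.
apply: (@le_trans _ _ (ereal_sup (u @` [set m | (u m <= l)%E]))).
  by apply: ereal_inf_lbound; exists [set m | (u m <= l)%E].
by apply: ge_ereal_sup => _ [m ? <-].
Qed.

Lemma limn_einf_ge_near (R : realType) (u : (\bar R)^nat) (l : \bar R) :
  (\forall m \near \oo, (l <= u m)%E) -> (l <= limn_einf u)%E.
Proof.
move=> lu; rewrite /limn_einf leeNr; apply: limn_esup_le_near.
by apply: filterS lu => m; rewrite leeN2.
Qed.

Lemma sqrt_large (R : realType) (c : R) :
  exists N : nat, forall m, (N <= m)%N -> c <= Num.sqrt m%:R.
Proof.
exists (Num.bound (c ^+ 2)) => m Nm; have [c0|c0] := lerP c 0.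
  by rewrite (le_trans c0) // sqrtr_ge0.
apply: le_trans (ler_norm c) _; rewrite -sqrtr_sqr ler_sqrt //.
by rewrite (le_trans (ltW (archi_boundP (sqr_ge0 c)))) // ler_nat.
Qed.

Lemma affine_market_loss (R : realType) (n : nat) (gamma : R) : 0 < gamma ->
  ((3 / 10 / gamma * n%:R)%:E <=
     limn_einf (fun eta : nat =>
       (fluid_loss (affine_market R n) (fun=> 1%R) (fun=> 1%R)
          (randomized (@diagonal R n)) (gamma * Num.sqrt eta%:R) eta /
        Num.sqrt eta%:R)%:E))%E.
Proof.
move=> g0; apply: limn_einf_ge_near.
have [N rN] := @sqrt_large R (gamma^-1 + 1).
exists N.+1 => // m /= Nm; rewrite lee_fin.
have m0 : (0 < m)%N by exact: leq_trans Nm.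
have := rN m (ltnW Nm); set r := Num.sqrt m%:R => rg.
have gi : 0 < gamma^-1 by rewrite invr_gt0.
have r0 : 0 < r by lra.
have rr : r * r = m%:R by rewrite -expr2 sqr_sqrtr.
have gr : 1 <= gamma * r.
  by rewrite -[leLHS](mulfV (lt0r_neq0 g0)) ler_pM2l //; lra.
have [K [Kq qK Kq1]] := nat_cap (ltW (lt_le_trans ltr01 gr)).
have K0 : (0 < K)%N by rewrite -Kq (lt_le_trans ltr01).
have [_ _ opt _ _] := affine_market_setting R n.
have d0 (i j : 'I_n) : 0 <= @diagonal R n i j by exact: ler0n.
have o0 (k : 'I_n) : 0 <= (fun=> 1 : R) k by exact: ler01.
have [E Es ->] := fluid_loss_steady opt o0 o0 (randomized_greedy d0) m0 Kq.
have {}Es : steady K (fun i j => i == j) (fun=> 1) (fun=> 1)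
    (randomized (@diagonal R n)) E.
  have -> // : (fun i j : 'I_n => i == j) = fun i j => @diagonal R n i j != 0.
  apply/funext => i; apply/funext => j.
  by rewrite /diagonal pnatr_eq0 eqb0 negbK.
clear o0 d0; pose b : R := (2 * K%:R + 1)^-1.
under eq_bigr => j _ do rewrite (diagonal_blocking j K0 Es).1 /=.
under [X in _ - X]eq_bigr => j _ do rewrite (diagonal_blocking j K0 Es).2 /=.
rewrite -/b !sumr_const card_ord -mulrnBl.
set Z := \sum_j _ + _.
have Z0 : 0 <= Z.
  by rewrite addr_ge0 // sumr_ge0 // => j _; rewrite mul1r;
    apply: (steady_ge0 Es) => q _.
(* Since [K < gamma r + 1] and [1 <= gamma r], one has [2 K + 1 <= 5 gamma r]. With the margin
   [3 / 2] this gives the constant [3 / 10 / gamma]; waiting costs are dropped. *)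
have b1 : (5 * (gamma * r))^-1 <= b.
  by rewrite lef_pV2 ?posrE; lra.
rewrite ler_pdivlMr //; apply: (@le_trans _ _ (m%:R * ((3 / 2 * b) *+ n))); last first.
  rewrite -[leLHS]addr0 lerD // ler_wpM2l // lerMn2r.
  by apply/orP; right; lra.
rewrite -[(3 / 2 * b) *+ n]mulr_natl -rr.
have -> : 3 / 10 / gamma * n%:R * r =
    r * r * (n%:R * (3 / 2 * (5 * (gamma * r))^-1)).
  by field; rewrite !gt_eqF.
by rewrite !ler_wpM2l // ?mulr_ge0 // ltW.
Qed.

(** * Max-weight matching *)

(** Maximum minus minimum; truncated subtraction discards the negative differences. *)
Definition spread (n : nat) (f : 'I_n -> nat) : nat :=
  \max_j \max_j' (f j - f j')%N.

Section Spread.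
Variables (n : nat) (f : 'I_n -> nat).

Lemma leq_spread (j j' : 'I_n) : (f j <= f j' + spread f)%N.
Proof.
rewrite -leq_subLR; apply: leq_trans (bigop.leq_bigmax j).
exact: (bigop.leq_bigmax (F := fun j' => f j - f j')%N j').
Qed.

Lemma spread_attained : (0 < n)%N -> exists j j', f j = (f j' + spread f)%N.
Proof.
move=> n0; have c0 : (0 < #|'I_n|)%N by rewrite card_ord.
have [j sE] := bigop.eq_bigmax (fun j => \max_j' (f j - f j'))%N c0.
have [j' sE'] := bigop.eq_bigmax (fun j' => f j - f j')%N c0.
rewrite /spread sE sE'; have [jj|/ltnW jj] := leqP (f j') (f j).
  by exists j, j'; rewrite subnKC.
by exists j, j; rewrite (eqP jj) addn0.
Qed.

End Spread.

(* Summing the pooling inequality over the level sets of [f]. *)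
Lemma pooling_gap (R : realType) (n : nat) (lam mu : 'I_n -> R)
    (adj : 'I_n -> 'I_n -> bool) (eps : R) (f : 'I_n -> nat) :
  (0 < n)%N -> 0 <= eps -> (forall i, 0 <= mu i) ->
  \sum_j lam j = \sum_i mu i -> (forall i, exists j, adj i j) ->
  (forall J : {set 'I_n}, J != finset.set0 -> J != finset.setT ->
     \sum_(j in J) lam j + eps <=
     \sum_(i | [exists j in J, adj i j]) mu i) ->
  \sum_j lam j * (f j)%:R + eps * (spread f)%:R <=
  \sum_i mu i * (\max_(j | adj i j) f j)%:R.
Proof.
move=> n0 e0 u0 lu nb pool.
have [jM [jm fM]] := spread_attained f n0.
have fleM j : (f j <= f jM)%N by rewrite fM leq_spread.
have fgem j : (f jm <= f j)%N.
  by rewrite -(leq_add2r (spread f)) -fM leq_spread.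
pose m i := \max_(j | adj i j) f j.
have layer (x : nat) : (x <= f jM)%N -> x%:R = \sum_(k < f jM) (k < x)%N%:R :> R.
  have -> : \sum_(k < f jM) (k < x)%N%:R = (minn (f jM) x)%:R :> R.
    elim: (f jM) => [|N IH]; first by rewrite big_ord0 min0n.
    by rewrite big_ord_recr /= IH -natrD; congr (_%:R); lia.
  by move=> /minn_idPr ->.
have layers (w : 'I_n -> R) (g : 'I_n -> nat) : (forall i, g i <= f jM)%N ->
    \sum_i w i * (g i)%:R = \sum_(k < f jM) \sum_i w i * (k < g i)%N%:R.
  move=> gM; rewrite exchange_big /=; apply: eq_bigr => i _.
  by rewrite (layer _ (gM i)) mulr_sumr.
have mM i : (m i <= f jM)%N by apply/bigop.bigmax_leqP => j _.
(* The spread counts the levels between minimum and maximum, where the level set is nonempty and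
   proper and [pool] gains [eps]. *)
have -> : (spread f)%:R = \sum_(k < f jM) ((k < f jM)%N%:R - (k < f jm)%N%:R) :> R.
  by rewrite sumrB -!layer // fM natrD; ring.
rewrite !layers // mulr_sumr -big_split; apply: ler_sum => k _ /=.
have sumJ (w : 'I_n -> R) (P : pred 'I_n) :
    \sum_i w i * (P i)%:R = \sum_(i | P i) w i.
  by rewrite [RHS]big_mkcond; apply: eq_bigr => i _; case: (P i);
    rewrite ?mulr1 ?mulr0.
have mE i j : adj i j -> (k < f j)%N -> (k < m i)%N.
  by move=> ij kj; apply: leq_trans kj _; exact: bigop.leq_bigmax_cond.
rewrite !sumJ; pose J := [set j : 'I_n | (k < f j)%N]%SET.
have [kM|kM] := ltnP k (f jM); last first.
  rewrite big_pred0 => [|j]; last by apply/negbTE; rewrite -leqNgt (leq_trans (fleM j)).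
  by rewrite [(k < f jm)%N]ltnNge (leq_trans (fleM jm)) //= subrr mulr0 addr0 sumr_ge0.
(* Below the minimum the level set is everything, and equality of the total rates takes the place of
   pooling. *)
have [km|km] := ltnP k (f jm).
  rewrite subrr mulr0 addr0 (eq_bigl xpredT) => [|j]; last by rewrite (leq_trans km).
  rewrite lu [leRHS](eq_bigl xpredT) // => i.
  by have [j ij] := nb i; apply: mE ij _; rewrite (leq_trans km).
rewrite subr0 mulr1.
have J0 : J != finset.set0 by apply/set0Pn; exists jM; rewrite inE.
have JT : J != finset.setT.
  apply/eqP => /setP /(_ jm); rewrite !inE ltnNge.
  by rewrite km.
have := pool J J0 JT; rewrite (eq_bigl (fun j => k < f j)%N) => [h|j]; last first.
  by rewrite inE.
apply: le_trans h _; rewrite [leRHS]big_mkcond [leLHS]big_mkcond /=.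
apply: ler_sum => i _; case: ifP => [/existsP[j]|_]; last by case: ifP.
by rewrite inE => /andP[kj ij]; rewrite (mE _ _ ij kj).
Qed.

(** * The imbalance potential and its increments *)

Section Potential.
Variables (R : realType) (n : nat).
Hypothesis n0 : (0 < n)%N.
Implicit Types a b : {ffun 'I_n -> nat}.

Definition qtotal a : R := \sum_j (a j)%:R.
Definition energy a : R := \sum_j (a j)%:R * (a j)%:R.

(* Vanishes when one side is empty and the queues of the other are equal. *)
Definition potential a b : R :=
  energy a + energy b - (qtotal a - qtotal b) * (qtotal a - qtotal b) / n%:R.

Definition drift a b (k : 'I_n) (x : nat) : R :=
  1 + 2 * (a k)%:R - 2 * x%:R - (2 * (qtotal a - qtotal b) + 1) / n%:R.

Lemma potentialC a b : potential a b = potential b a.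
Proof. by rewrite /potential; ring. Qed.

Lemma total_join a k : qtotal (join_queue a k) = qtotal a + 1.
Proof.
rewrite /qtotal (bigD1 k) //= [in RHS](bigD1 k) //= ffunE eqxx natrD addrAC; congr (_ + _ + _).
by apply: eq_bigr => j jk; rewrite ffunE (negbTE jk) addn0.
Qed.

Lemma total_leave a k : (0 < a k)%N -> qtotal (leave_queue a k) = qtotal a - 1.
Proof.
move=> ak; rewrite /qtotal (bigD1 k) //= [in RHS](bigD1 k) //= ffunE eqxx natrB // addrAC.
by congr (_ + _ + _); apply: eq_bigr => j jk; rewrite ffunE (negbTE jk) subn0.
Qed.

Lemma energy_join a k : energy (join_queue a k) = energy a + (2 * (a k)%:R + 1).
Proof.
rewrite /energy (bigD1 k) //= [in RHS](bigD1 k) //= ffunE eqxx natrD addrAC /=; congr (_ + _); first by ring.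
by apply: eq_bigr => j jk; rewrite ffunE (negbTE jk) addn0.
Qed.

Lemma energy_leave a k : (0 < a k)%N ->
  energy (leave_queue a k) = energy a + (1 - 2 * (a k)%:R).
Proof.
move=> ak; rewrite /energy (bigD1 k) //= [in RHS](bigD1 k) //= ffunE eqxx natrB // addrAC /=.
congr (_ + _); first by ring.
by apply: eq_bigr => j jk; rewrite ffunE (negbTE jk) subn0.
Qed.

Lemma nR_neq0 : n%:R != 0 :> R.
Proof. by rewrite pnatr_eq0 -lt0n. Qed.

Lemma nR_gt0 : 0 < n%:R :> R.
Proof. by rewrite ltr0n. Qed.

Lemma total_arrival comp (m : 'I_n -> R) a b k (h : R -> R) :
  greedy_dist comp b m ->
  arrival m a b k (fun a b => h (qtotal a - qtotal b)) =
  h (qtotal a - qtotal b + 1) - h (qtotal a - qtotal b).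
Proof.
move=> [_ mN0 _]; apply: arrival_cst => [i /mN0 /andP[_ bi]|_].
  by rewrite total_leave //; congr (h _ - _); ring.
by rewrite total_join; congr (h _ - _); ring.
Qed.

Lemma longest_queue_greedy comp (len : 'I_n -> nat) (p : 'I_n -> R) :
  longest_queue comp len p -> greedy_dist comp len p.
Proof.
move=> [p0 pN0 p1]; split => // [k /pN0[-> -> _]//|k ck lk].
by apply: p1; exists k.
Qed.

(** Max-weight enters here: whichever maximizer is served, its length is the maximum, so the
    tie-breaking rule does not affect the increment. *)
Lemma potential_arrival comp (m : 'I_n -> R) a b k (h : R -> R) :
  longest_queue comp b m -> (forall i, comp i -> a k = 0%N \/ b i = 0%N) ->
  arrival m a b k (fun a b => h (potential a b)) =
  h (potential a b + drift a b k (\max_(i | comp i) b i)) - h (potential a b).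
Proof.
move=> mw ex; have [m0 mN0 m1] := mw.
apply: arrival_cst => [i /mN0 [ci bi bM]|mN1].
  have -> : \max_(i | comp i) b i = b i.
    apply/eqP; rewrite eqn_leq bigop.leq_bigmax_cond // andbT.
    by apply/bigop.bigmax_leqP.
  have [ak|bi0] := ex i ci; last by rewrite bi0 in bi.
  congr (h _ - _); rewrite /potential /drift energy_leave // total_leave // ak.
  by field; exact: nR_neq0.
have b0 i : comp i -> b i = 0%N.
  have [[s1 _]|[+ _]] := greedy_distP (longest_queue_greedy mw); last exact.
  by rewrite s1 subrr eqxx in mN1.
rewrite big1 //; congr (h _ - _).
rewrite /potential /drift energy_join total_join.
by field; exact: nR_neq0.
Qed.

Lemma total_le a (c : R) : (forall j, (a j)%:R <= c) -> qtotal a <= n%:R * c.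
Proof.
move=> ac; apply: (@le_trans _ _ (\sum_(j < n) c)); first exact: ler_sum.
by rewrite sumr_const card_ord mulr_natl.
Qed.

Lemma total_ge a (c : R) : (forall j, c <= (a j)%:R) -> n%:R * c <= qtotal a.
Proof.
move=> ac; apply: (@le_trans _ _ (\sum_(j < n) c)); last exact: ler_sum.
by rewrite sumr_const card_ord mulr_natl.
Qed.

Lemma total_ge0 a : 0 <= qtotal a.
Proof. exact: sumr_ge0. Qed.

Lemma dist_mean_le a j : `|(a j)%:R - qtotal a / n%:R| <= (spread a)%:R.
Proof.
have sp k l : (a k)%:R <= (a l)%:R + (spread a)%:R :> R.
  by rewrite -natrD ler_nat leq_spread.
rewrite ler_distl lerBlDr -[X in _ && X]lerBlDr; apply/andP; split.
  rewrite ler_pdivrMr ?nR_gt0 // mulrC; exact: total_le.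
rewrite ler_pdivlMr ?nR_gt0 // mulrC; apply: total_ge => k.
by rewrite lerBlDr.
Qed.

(** Written through deviations from the mean queue lengths, the drift contains no totals. *)
Lemma drift_bound a b k i :
  `|drift a b k (b i)| <= 1 + 2 * ((spread a)%:R + (spread b)%:R).
Proof.
have -> : drift a b k (b i) = (1 - n%:R^-1) +
    2 * ((a k)%:R - qtotal a / n%:R) - 2 * ((b i)%:R - qtotal b / n%:R).
  by rewrite /drift; field; exact: nR_neq0.
have := dist_mean_le a k; have := dist_mean_le b i.
have : 0 < n%:R^-1 :> R by rewrite invr_gt0 nR_gt0.
have : n%:R^-1 <= 1 :> R by rewrite invf_le1 ?nR_gt0 // ler1n.
rewrite !ler_norml => ? ? /andP[? ?] /andP[? ?]; apply/andP; split; lra.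
Qed.

Lemma energy_mean a : energy a - qtotal a * qtotal a / n%:R =
  \sum_j ((a j)%:R - qtotal a / n%:R) * ((a j)%:R - qtotal a / n%:R).
Proof.
under [RHS]eq_bigr => j _.
  rewrite (_ : _ * _ = (a j)%:R * (a j)%:R - 2 * (qtotal a / n%:R) * (a j)%:R +
    (qtotal a / n%:R) * (qtotal a / n%:R)); last by ring.
  over.
rewrite big_split sumrB /= -mulr_sumr -/(qtotal a) -/(energy a) sumr_const card_ord.
by rewrite -mulr_natl; field; exact: nR_neq0.
Qed.

(** Expanding the square of the difference of totals leaves one sum of squared deviations per side
    and a nonnegative cross term. *)
Lemma potentialE a b : potential a b =
  \sum_j ((a j)%:R - qtotal a / n%:R) * ((a j)%:R - qtotal a / n%:R) +
  \sum_j ((b j)%:R - qtotal b / n%:R) * ((b j)%:R - qtotal b / n%:R) +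
  2 * (qtotal a * qtotal b) / n%:R.
Proof. by rewrite -!energy_mean /potential; field; exact: nR_neq0. Qed.

Lemma spread_sqr_le a : (spread a)%:R * (spread a)%:R / 4 <=
  \sum_j ((a j)%:R - qtotal a / n%:R) * ((a j)%:R - qtotal a / n%:R).
Proof.
have [j [j' aE]] := spread_attained a n0.
have aER : (a j)%:R = (a j')%:R + (spread a)%:R :> R by rewrite -natrD -aE.
set t := qtotal a / n%:R.
have term k : ((a k)%:R - t) * ((a k)%:R - t) <=
    \sum_j ((a j)%:R - t) * ((a j)%:R - t).
  rewrite [leRHS](bigD1 k) //= lerDl sumr_ge0 // => l _.
  by rewrite -expr2 sqr_ge0.
have := term j; have := term j'; rewrite aER; set X := \sum_j _ => h1 h2.
(* For deviations [u + s] and [u] at the extreme queues, [(u + s)^2 + u^2] is half of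
   [(2 u + s)^2 + s^2], hence at least [s^2 / 2]. *)
have := sqr_ge0 ((a j')%:R + (spread a)%:R - t + ((a j')%:R - t)).
rewrite expr2 => h3; nra.
Qed.

Lemma potential_ge a b :
  ((spread a)%:R + (spread b)%:R) * ((spread a)%:R + (spread b)%:R) / 8 <=
  potential a b.
Proof.
rewrite potentialE; have := spread_sqr_le a; have := spread_sqr_le b.
have : 0 <= 2 * (qtotal a * qtotal b) / n%:R :> R.
  by rewrite divr_ge0 // !mulr_ge0 // total_ge0.
have := sqr_ge0 ((spread a)%:R - (spread b)%:R : R); rewrite expr2.
by move=> ? ? ? ?; nra.
Qed.

Lemma potential_le a b :
  qtotal a * qtotal b <= n%:R * (spread a)%:R * (n%:R * (spread b)%:R) ->
  potential a b <=
  n%:R * (((spread a)%:R + (spread b)%:R) * ((spread a)%:R + (spread b)%:R)).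
Proof.
move=> tt; rewrite potentialE.
have var (c : {ffun 'I_n -> nat}) :
    \sum_j ((c j)%:R - qtotal c / n%:R) * ((c j)%:R - qtotal c / n%:R) <=
    n%:R * ((spread c)%:R * (spread c)%:R).
  apply: (@le_trans _ _ (\sum_(j < n) ((spread c)%:R * (spread c)%:R))).
    apply: ler_sum => j _; rewrite -!expr2 -real_normK ?num_real //.
    by rewrite lerXn2r ?nnegrE // dist_mean_le.
  by rewrite sumr_const card_ord [leRHS]mulr_natl.
have := var a; have := var b.
have : 2 * (qtotal a * qtotal b) / n%:R <= 2 * n%:R * ((spread a)%:R * (spread b)%:R).
  by rewrite ler_pdivrMr ?nR_gt0 //; lra.
by move=> ? ? ?; nra.
Qed.

End Potential.

(* If agents wait on both sides, each side also has an empty queue, and its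
   total is at most [n] times its spread. *)
Lemma good_totals (R : realType) (n K : nat) (adj : 'I_n -> 'I_n -> bool)
    (q : state n) : good K adj q ->
  (forall i, exists j, adj i j) -> (forall j, exists i, adj i j) ->
  qtotal R q.1 * qtotal R q.2 <=
  n%:R * (spread q.1)%:R * (n%:R * (spread q.2)%:R).
Proof.
move=> [_ _ ex] nbs nbc.
have low (a : {ffun 'I_n -> nat}) k : a k = 0%N -> qtotal R a <= n%:R * (spread a)%:R.
  move=> ak; apply: total_le => j; rewrite ler_nat.
  by have := leq_spread a j k; rewrite ak.
have rhs0 : 0 <= n%:R * (spread q.1)%:R * (n%:R * (spread q.2)%:R) :> R.
  by rewrite !mulr_ge0.
have zero (a : {ffun 'I_n -> nat}) : (forall k, ~~ (0 < a k)%N) -> qtotal R a = 0.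
  by move=> a0; rewrite /qtotal big1 // => k _; case: (a k) (a0 k).
have [/existsP[i bi]|/existsPn /zero ->] := boolP [exists i, 0 < q.2 i]%N; last first.
  by rewrite mulr0.
have [/existsP[j aj]|/existsPn /zero ->] := boolP [exists j, 0 < q.1 j]%N; last first.
  by rewrite mul0r.
apply: ler_pM; rewrite ?total_ge0 //.
  have [k ik] := nbs i; apply: (low _ k).
  by have [//|b0] := ex _ _ ik; move: bi; rewrite [q.2 i]b0.
have [k kj] := nbc j; apply: (low _ k).
by have [a0|//] := ex _ _ kj; move: aj; rewrite [q.1 j]a0.
Qed.

(** If [s >= a / b] the left side is nonpositive; otherwise [s^2] is at most [a^2 / b^2]. *)
Lemma cubic_drift (R : realType) (a b s : R) : 0 <= a -> 0 < b -> 0 <= s ->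
  a * (s * s) - b * (s * s * s) <= a * a * a / (b * b).
Proof.
move=> a0 b0 s0; rewrite ler_pdivlMr ?mulr_gt0 //.
have [abs|abs] := lerP a (b * s).
  apply: (@le_trans _ _ 0); last by rewrite !mulr_ge0.
  by rewrite mulr_le0_ge0 ?mulr_ge0 // ?(ltW b0) // subr_le0 mulrA [b * _]mulrC
    -!mulrA [s * (s * _)]mulrA mulrCA mulrA; nra.
have bs0 : 0 <= b * s by rewrite mulr_ge0 // ltW.
have h : (b * s) * (b * s) <= a * a by apply: ler_pM => //; exact: ltW.
have h2 : a * ((b * s) * (b * s)) <= a * (a * a) by rewrite ler_wpM2l.
have h3 : 0 <= b * (s * s * s) * (b * b) by rewrite !mulr_ge0 // ltW.
nra.
Qed.

(** * State space collapse and blocking under max-weight matching *)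

Section MaxWeight.
Variables (R : realType) (n : nat) (M : market R n) (lam mu : 'I_n -> R) (eps : R).
Hypothesis n0 : (0 < n)%N.
Hypothesis eps0 : 0 < eps.
Hypothesis lam0 : forall j, 0 <= lam j.
Hypothesis mu0 : forall i, 0 <= mu i.
Hypothesis lamu : \sum_j lam j = \sum_i mu i.
Hypothesis nbs : forall i, exists j, compat M i j.
Hypothesis nbc : forall j, exists i, compat M i j.
Hypothesis poolc : forall J : {set 'I_n}, J != finset.set0 -> J != finset.setT ->
  \sum_(j in J) lam j + eps <= \sum_(i | [exists j in J, compat M i j]) mu i.
Hypothesis pools : forall I : {set 'I_n}, I != finset.set0 -> I != finset.setT ->
  \sum_(i in I) mu i + eps <= \sum_(j | [exists i in I, compat M i j]) lam j.

Let W (q : state n) : R := potential R q.1 q.2.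
Let S (q : state n) : R := (spread q.1)%:R + (spread q.2)%:R.
Let z (q : state n) : R := qtotal R q.1 - qtotal R q.2.
Let Lam : R := \sum_j lam j.
Let dc (q : state n) j := drift R q.1 q.2 j (\max_(i | compat M i j) q.2 i).
Let ds (q : state n) i := drift R q.2 q.1 i (\max_(j | compat M i j) q.1 j).

Lemma max_weight_greedy (mt : matching R n) :
  max_weight M mt -> greedy (compat M) mt.
Proof. by move=> mw q; split => k; apply: longest_queue_greedy; apply mw. Qed.

Lemma generator_potential K mt (h : R -> R) q :
  max_weight M mt -> good K (compat M) q ->
  generator (capped K lam (@qc n)) (capped K mu (@qs n)) mt
    (fun q => h (W q)) q =
  \sum_j capped K lam (@qc n) q j * (h (W q + dc q j) - h (W q)) +
  \sum_i capped K mu (@qs n) q i * (h (W q + ds q i) - h (W q)).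
Proof.
move=> mw [_ _ ex]; rewrite /generator; congr (_ + _); apply: eq_bigr => k _;
  congr (_ * _).
  apply: (@potential_arrival R n n0 (fun i => compat M i k) _ q.1 q.2 k h).
    exact: (mw q).2.
  by move=> i /ex.
have -> : (fun a b => h (W (b, a))) = (fun a b => h (potential R a b)).
  by apply/funext => a; apply/funext => b; rewrite /W potentialC.
rewrite /W potentialC.
apply: (@potential_arrival R n n0 (fun j => compat M k j) _ q.2 q.1 k h).
  exact: (mw q).1.
by move=> j /ex[|]; [right|left].
Qed.

(** A full queue is at least as long as the average of its side, so a further arrival could only
    raise the potential. *)
Lemma drift_ge0 K (a b : {ffun 'I_n -> nat}) k x :
  (forall j, a j <= K)%N -> a k = K -> x = 0%N -> 0 <= drift R a b k x.
Proof.
move=> aK ak ->; rewrite /drift ak mulr0 subr0 subr_ge0.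
rewrite ler_pdivrMr ?nR_gt0 //.
have tK : qtotal R a <= n%:R * K%:R by apply: total_le => j; rewrite ler_nat.
have b0 := total_ge0 R b; have n1 : 1 <= n%:R :> R by rewrite ler1n.
nra.
Qed.

(** Blocking removes only nonnegative terms, so the buffer may be ignored in an upper bound of the
    drift. *)
Lemma capped_drift_le K q : (0 < K)%N -> good K (compat M) q ->
  \sum_j capped K lam (@qc n) q j * dc q j +
  \sum_i capped K mu (@qs n) q i * ds q i <=
  \sum_j lam j * dc q j + \sum_i mu i * ds q i.
Proof.
move=> K0 [cK sK ex].
have one (w : 'I_n -> R) (a : {ffun 'I_n -> nat}) (d : 'I_n -> R) :
    (forall k, 0 <= w k) -> (forall k, a k = K -> 0 <= d k) ->
    (forall k, (a k <= K)%N) ->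
    \sum_k w k * (a k < K)%N%:R * d k <= \sum_k w k * d k.
  move=> w0 d0 aK; apply: ler_sum => k _.
  have := aK k; rewrite leq_eqVlt => /orP[/eqP ak|->]; last by rewrite mulr1.
  by rewrite ak ltnn mulr0 mul0r mulr_ge0 // d0.
apply: lerD; apply: one => // k kK.
  apply: (drift_ge0 (K := K)) => //; apply: big1 => i /ex[|//].
  by rewrite /qc kK => KK; rewrite KK in K0.
apply: (drift_ge0 (K := K)) => //; apply: big1 => j /ex[//|].
by rewrite /qs kK => KK; rewrite KK in K0.
Qed.

(** As both sides have total rate [Lam], the terms in the difference of totals cancel;
    [pooling_gap], once per side, yields [- 2 eps S]. *)
Lemma drift_sum_le q :
  \sum_j lam j * dc q j + \sum_i mu i * ds q i <= 2 * Lam - 2 * eps * S q.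
Proof.
have gc := @pooling_gap R n lam mu (compat M) eps q.1 n0 (ltW eps0) mu0 lamu nbs poolc.
have gs := @pooling_gap R n mu lam (fun j i => compat M i j) eps q.2 n0 (ltW eps0)
  lam0 (esym lamu) nbc pools.
have split (w : 'I_n -> R) (a b : {ffun 'I_n -> nat}) (x : 'I_n -> nat) :
    \sum_k w k * drift R a b k (x k) =
    (\sum_k w k) * (1 - (2 * (qtotal R a - qtotal R b) + 1) / n%:R) +
    2 * (\sum_k w k * (a k)%:R) - 2 * (\sum_k w k * (x k)%:R).
  rewrite mulr_suml !mulr_sumr -big_split -sumrB /=.
  by apply: eq_bigr => k _; rewrite /drift; ring.
rewrite !split -lamu -/Lam /S.
have L0 : 0 <= Lam by exact: sumr_ge0.
have Ln : 0 <= Lam * n%:R^-1 by rewrite mulr_ge0 // invr_ge0.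
nra.
Qed.

(** From [(W + d)^2 - W^2 = 2 W d + d^2]: the first-order part is controlled by the drift of [W],
    the second by [drift_bound]. *)
Lemma generator_potential_sqr K mt q :
  (0 < K)%N -> max_weight M mt -> good K (compat M) q ->
  generator (capped K lam (@qc n)) (capped K mu (@qs n)) mt
    (fun q => W q * W q) q <=
  2 * W q * (2 * Lam - 2 * eps * S q) +
  2 * Lam * ((1 + 2 * S q) * (1 + 2 * S q)).
Proof.
move=> K0 mw gq; rewrite (generator_potential (fun x => x * x) mw gq).
have S0 : 0 <= S q by rewrite addr_ge0.
have W0 : 0 <= W q by apply: le_trans (potential_ge R n0 q.1 q.2); rewrite divr_ge0 // mulr_ge0.
have nbmax (P : pred 'I_n) (b : {ffun 'I_n -> nat}) : (exists i, P i) ->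
    exists i, \max_(i | P i) b i = b i.
  move=> [i Pi]; have c0 : (0 < #|P|)%N by apply/card_gt0P; exists i.
  by have [k _ kE] := bigop.eq_bigmax_cond b c0; exists k.
have dcb j : `|dc q j| <= 1 + 2 * S q.
  by have [i iE] := nbmax _ q.2 (nbc j); rewrite /dc iE drift_bound.
have dsb i : `|ds q i| <= 1 + 2 * S q.
  have [j jE] := nbmax _ q.1 (nbs i).
  by rewrite /ds jE /S [(spread q.1)%:R + _]addrC drift_bound.
have step (w : 'I_n -> R) len (d : 'I_n -> R) : (forall k, 0 <= w k) ->
    (forall k, `|d k| <= 1 + 2 * S q) ->
    \sum_k capped K w len q k * ((W q + d k) * (W q + d k) - W q * W q) <=
    2 * W q * (\sum_k capped K w len q k * d k) +
    (\sum_k w k) * ((1 + 2 * S q) * (1 + 2 * S q)).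
  move=> w0 dS; rewrite mulr_sumr mulr_suml -big_split /=.
  apply: ler_sum => k _.
  have -> : (W q + d k) * (W q + d k) - W q * W q = 2 * W q * d k + d k * d k by ring.
  rewrite mulrDr mulrCA lerD2l.
  have dd : d k * d k <= (1 + 2 * S q) * (1 + 2 * S q).
    by rewrite -!expr2 -real_normK ?num_real // lerXn2r ?nnegrE // addr_ge0 // mulr_ge0.
  have c1 : capped K w len q k <= w k by rewrite ler_piMr // lern1 leq_b1.
  by apply: ler_pM => //; [rewrite mulr_ge0|rewrite -expr2 sqr_ge0].
apply: le_trans (lerD (step lam _ _ lam0 dcb) (step mu _ _ mu0 dsb)) _.
rewrite -lamu -/Lam.
have := le_trans (capped_drift_le K0 gq) (drift_sum_le q).
set X := \sum_j _; set Y := \sum_i _ => XY.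
have : 2 * W q * (X + Y) <= 2 * W q * (2 * Lam - 2 * eps * S q).
  by rewrite ler_wpM2l // mulr_ge0.
by move=> ?; lra.
Qed.

(** The drift of [W^2] is at most a quadratic in [S] minus a multiple of [S^3], since [W] lies
    between multiples of [S^2]. The constant depends neither on [K] nor on the tie-breaking. *)
Lemma collapse : exists2 C : R, 0 < C & forall K mt E, (0 < K)%N ->
  max_weight M mt -> steady K (compat M) lam mu mt E ->
  E (fun q => S q * S q) <= C.
Proof.
have L0 : 0 <= Lam by exact: sumr_ge0.
(* The first two terms collect the coefficients of [S^2], with [S <= 1 / 4 + S^2]; the final 1
   produces the [S^2] to be bounded. Below, [b] comes from [4 eps S W >= eps S^3 / 2]. *)
pose a := 4 * Lam * n%:R + 16 * Lam + 1.
have a0 : 0 < a by rewrite ltr_wpDl // addr_ge0 // !mulr_ge0.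
pose b := eps / 2.
have b0 : 0 < b by rewrite divr_gt0.
exists (4 * Lam + a * a * a / (b * b)).
  by rewrite ltr_wpDl ?mulr_ge0 // divr_gt0 // !mulr_gt0.
move=> K mt E K0 mw Es; rewrite -subr_ge0.
rewrite -[X in X - _](steady_cst Es) -(steadyB Es).
apply: (steady_generator_le Es (f := fun q => W q * W q)) => q gq.
apply: le_trans (generator_potential_sqr K0 mw gq) _.
have S0 : 0 <= S q by rewrite addr_ge0.
have WS := potential_ge R n0 q.1 q.2; rewrite -/(S q) -/(W q) in WS.
have SW := potential_le n0 (good_totals R gq nbs nbc); rewrite -/(S q) -/(W q) in SW.
have h1 : Lam * W q <= Lam * (n%:R * (S q * S q)) by rewrite ler_wpM2l.
have h2 : eps * S q * (S q * S q / 8) <= eps * S q * W q.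
  by rewrite ler_wpM2l // mulr_ge0 // ltW.
have h3 : Lam * S q <= Lam * (1 / 4 + S q * S q).
  have := sqr_ge0 (S q - 1 / 2); rewrite expr2 => h.
  by rewrite ler_wpM2l //; lra.
have h4 := cubic_drift (ltW a0) b0 S0.
apply: (@le_trans _ _ (4 * Lam + (a * (S q * S q) - b * (S q * S q * S q)) - S q * S q)); last by lra.
rewrite /a /b; lra.
Qed.

Lemma max_weight_blocking : exists K0 : nat, forall K mt E, (K0 < K)%N ->
  max_weight M mt -> steady K (compat M) lam mu mt E ->
  \sum_j lam j * E (fun q => (K <= qc q j)%N%:R) * (n%:R * K%:R) <= Lam.
Proof.
have [C C0 col] := collapse.
have nR := nR_gt0 R n0.
(* AM-GM parameter. It makes the [S^2] error at most [Lam], and [K >= d^-1] makes the other error a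
   quarter of the main term [2 n K]. The outcome is [3 n K A <= 3 Lam]: the spare factor 2 of the
   heuristic estimate pays for both errors. *)
pose d := (4 * n%:R * C)^-1.
have d0 : 0 < d by rewrite invr_gt0 !mulr_gt0.
exists (Num.bound (d^-1)) => K mt E KK0 mw Es.
have K0 : (0 < K)%N by exact: leq_ltn_trans KK0.
have dK : d^-1 <= K%:R.
  have di : 0 <= d^-1 by rewrite invr_ge0 ltW.
  by apply: le_trans (ltW (archi_boundP di)) _; rewrite ler_nat ltnW.
have L0 : 0 <= Lam by exact: sumr_ge0.
have gr := max_weight_greedy mw.
pose Bc q := \sum_j lam j * (K <= qc q j)%N%:R.
pose Bs q := \sum_i mu i * (K <= qs q i)%N%:R.
have capE (w : 'I_n -> R) (len : state n -> 'I_n -> nat) q :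
    \sum_k capped K w len q k =
    \sum_k w k - \sum_k w k * (K <= len q k)%N%:R.
  rewrite -sumrB; apply: eq_bigr => k _; rewrite /capped.
  by rewrite [(K <= _)%N]leqNgt; case: (_ < K)%N => /=; ring.
have gen (h : R -> R) q :
    generator (capped K lam (@qc n)) (capped K mu (@qs n)) mt
      (fun q => h (z q)) q =
    (Lam - Bc q) * (h (z q + 1) - h (z q)) +
    (Lam - Bs q) * (h (z q - 1) - h (z q)).
  rewrite /generator {2}/Lam lamu -!capE !mulr_suml; congr (_ + _).
    by apply: eq_bigr => k _; congr (_ * _); exact: total_arrival ((gr q).2 k).
  apply: eq_bigr => k _; congr (_ * _).
  have -> : (fun a b => h (z (b, a))) =
      (fun a b : {ffun 'I_n -> nat} => (h \o -%R) (qtotal R a - qtotal R b)).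
    by apply/funext => a; apply/funext => b; rewrite /= opprB.
  rewrite (@total_arrival R n _ _ q.2 q.1 k (h \o -%R) ((gr q).1 k)) /=.
  by rewrite opprD !opprB.
have ABE : E Bs = E Bc.
  apply/eqP; rewrite -subr_eq0 -(steadyB Es) -(steady_generator Es z).
  by apply/eqP/(steady_eq Es) => q _; rewrite (gen id) /=; ring.
have B0 q : 0 <= Bc q + Bs q.
  by rewrite addr_ge0 // sumr_ge0 // => k _; rewrite mulr_ge0.
have BL q : Bc q + Bs q <= 2 * Lam.
  have -> : 2 * Lam = \sum_j lam j + \sum_i mu i by rewrite -lamu /Lam; ring.
  by apply: lerD; apply: ler_sum => k _; rewrite ler_piMr // lern1 leq_b1.
pose A := E Bc.
have S0 q : 0 <= S q by rewrite addr_ge0.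
have key : 0 <= E (fun q => (2 * Lam + 4 * n%:R * Lam * d * (S q * S q)) -
    (2 * n%:R * K%:R + 1 - n%:R / (2 * d)) * (Bc q + Bs q)).
  apply: (steady_generator_le Es (f := fun q => z q * z q)) => q gq.
  rewrite (gen (fun x => x * x)); have [cK sK ex] := gq.
  have low (a : {ffun 'I_n -> nat}) k j : a k = 0%N -> (a j)%:R <= (spread a)%:R :> R.
    by move=> ak; rewrite ler_nat; have := leq_spread a j k; rewrite ak.
  have hi (a : {ffun 'I_n -> nat}) k j : a k = K -> K%:R - (spread a)%:R <= (a j)%:R :> R.
    by move=> ak; rewrite lerBlDr -natrD ler_nat; have := leq_spread a k j; rewrite ak.
  (* If [j] is full, every customer queue is at least [K] minus its spread. A server type adjacent
     to [j] has an empty queue, so every server queue is at most its spread. *)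
  have zc j : qc q j = K -> n%:R * K%:R - n%:R * S q <= z q.
    move=> jK; have [i ij] := nbc j.
    have bi : q.2 i = 0%N.
      by have [j0|//] := ex _ _ ij; move: K0; rewrite -jK j0.
    have := total_ge (R := R) (fun l => hi q.1 j l jK).
    have := total_le (R := R) (fun l => low q.2 i l bi).
    by rewrite /z /S; lra.
  have zs i : qs q i = K -> n%:R * K%:R - n%:R * S q <= - z q.
    move=> iK; have [j ij] := nbs i.
    have aj : q.1 j = 0%N.
      by have [//|i0] := ex _ _ ij; move: K0; rewrite -iK i0.
    have := total_ge (R := R) (fun l => hi q.2 i l iK).
    have := total_le (R := R) (fun l => low q.1 j l aj).
    by rewrite /z /S; lra.
  have wt (w : 'I_n -> R) (len : 'I_n -> nat) (x : R) : (forall k, 0 <= w k) ->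
      (forall k, (len k <= K)%N) ->
      (forall k, len k = K -> n%:R * K%:R - n%:R * S q <= x) ->
      (\sum_k w k * (K <= len k)%N%:R) * (n%:R * K%:R - n%:R * S q) <=
      (\sum_k w k * (K <= len k)%N%:R) * x.
    move=> w0 lK lx; rewrite !mulr_suml; apply: ler_sum => k _.
    have := lK k; case: (ltngtP (len k) K) => // kK _ /=.
      by rewrite mulr0 !mul0r.
    by rewrite mulr1 ler_wpM2l // (lx k kK).
  have hc := wt lam (qc q) (z q) lam0 cK zc.
  have hs := wt mu (qs q) (- z q) mu0 sK zs.
  rewrite -/(Bc q) in hc; rewrite -/(Bs q) in hs.
  (* AM-GM: [s <= d s^2 + 1 / (4 d)] *)
  have am : S q <= d * (S q * S q) + (4 * d)^-1.
    have := sqr_ge0 (S q - (2 * d)^-1); rewrite expr2 => h.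
    have h' : 0 <= d * ((S q - (2 * d)^-1) * (S q - (2 * d)^-1)).
      by rewrite mulr_ge0 // ltW.
    have e : d * ((S q - (2 * d)^-1) * (S q - (2 * d)^-1)) =
        d * (S q * S q) + (4 * d)^-1 - S q by field; exact: lt0r_neq0.
    by rewrite -subr_ge0 -e.
  have h1 : (Bc q + Bs q) * S q <= (Bc q + Bs q) * (d * (S q * S q)) +
      (Bc q + Bs q) * (4 * d)^-1 by rewrite -mulrDr ler_wpM2l.
  have h2 : (Bc q + Bs q) * (d * (S q * S q)) <= 2 * Lam * (d * (S q * S q)).
    by rewrite ler_wpM2r // mulr_ge0 ?mulr_ge0 // ltW.
  have h3 : n%:R * ((Bc q + Bs q) * S q) <=
      n%:R * (2 * Lam * (d * (S q * S q)) + (Bc q + Bs q) * (4 * d)^-1).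
    by rewrite ler_wpM2l // (le_trans h1) // lerD2r.
  have -> : n%:R / (2 * d) = 2 * (n%:R * (4 * d)^-1) by field; exact: lt0r_neq0.
  lra.
rewrite (steadyB Es) (steadyD Es) (steady_cst Es) !(steadyZ Es) (steadyD Es) ABE -/A in key.
have A0 : 0 <= A.
  by apply: (steady_ge0 Es) => q _; rewrite sumr_ge0 // => j _; rewrite mulr_ge0.
have ES := col K mt E K0 mw Es.
have h1 : 4 * n%:R * Lam * d * E (fun q => S q * S q) <= Lam.
  apply: (@le_trans _ _ (4 * n%:R * Lam * d * C)).
    by rewrite ler_wpM2l // !mulr_ge0 // ltW.
  rewrite le_eqVlt; apply/orP; left; apply/eqP; rewrite /d.
  by field; rewrite !lt0r_neq0.
have h2 : n%:R / (2 * d) <= n%:R * K%:R / 2.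
  have -> : n%:R / (2 * d) = n%:R / 2 * d^-1 by field; exact: lt0r_neq0.
  by rewrite [leRHS]mulrAC ler_wpM2l // divr_ge0.
have h3 : (n%:R / (2 * d)) * A <= n%:R * K%:R / 2 * A by rewrite ler_wpM2r.
rewrite -mulr_suml.
have -> : \sum_j lam j * E (fun q => (K <= qc q j)%N%:R) = A.
  rewrite /A (steady_sum Es); apply: eq_bigr => j _; exact/esym/(steadyZ Es).
have nA : 0 <= n%:R * K%:R * A by rewrite !mulr_ge0.
lra.
Qed.

End MaxWeight.

(** * The loss under max-weight matching *)

Lemma uniform_gap (R : realType) (T : finType) (P : pred T) (f g : T -> R) :
  (forall t, P t -> f t < g t) ->
  exists2 eps, 0 < eps & forall t, P t -> f t + eps <= g t.
Proof.
(* The default 1 keeps the minimum positive when [P] is empty, as happens for pooling when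
   [n = 1]. *)
move=> fg; exists (\big[Num.min/1]_(t | P t) (g t - f t)).
  by elim/big_ind: _ => // [x y x0 y0|t /fg]; rewrite ?lt_min ?x0 // subr_gt0.
by move=> t Pt; rewrite addrC -lerBrDr bigmin_le_cond.
Qed.

Lemma max_weight_loss (R : realType) (n : nat) (M : market R n)
    (lam mu : 'I_n -> R) (chi : 'I_n -> 'I_n -> R) (mt : nat -> matching R n) :
  (0 < n)%N -> fluid_setting M lam mu chi -> pooling M lam mu ->
  (forall eta, max_weight M (mt eta)) ->
  (limn_esup (fun eta : nat =>
     (fluid_loss M lam mu (mt eta) (Num.sqrt (eta%:R / n%:R)) eta
        / Num.sqrt eta%:R)%:E)
   <= (max_weight_bound M lam mu)%:E)%E.
Proof.
move=> n0 st [poolc pools] mw.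
have [F0 G0 cc0 cs0 _] := fluid_setting_ge0 st.
have [_ [s [s' sK s'K] sc] opt l0 u0] := st.
have [[_ lamE muE _ _] _] := opt.
have lamu : \sum_j lam j = \sum_i mu i.
  rewrite (eq_bigr _ (fun j _ => lamE j)) exchange_big /=.
  by apply: eq_bigr => i _; rewrite muE.
have nbs i : exists j, compat M i j by exists (s i).
have nbc j : exists i, compat M i j by exists (s' j); rewrite -{2}(s'K j).
have ind (J : {set 'I_n}) : (J != finset.set0) && (J != finset.setT) ->
    J != finset.set0 /\ J != finset.setT by move/andP.
have [e1 e10 gap1] := uniform_gap (fun J h => poolc J (ind J h).1 (ind J h).2).
have [e2 e20 gap2] := uniform_gap (fun J h => pools J (ind J h).1 (ind J h).2).
pose ep := Num.min e1 e2.
have ep0 : 0 < ep by rewrite lt_min e10.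
have p1 (J : {set 'I_n}) : J != finset.set0 -> J != finset.setT ->
    \sum_(j in J) lam j + ep <= \sum_(i | [exists j in J, compat M i j]) mu i.
  move=> J0 JT; have := gap1 J; rewrite J0 JT => /(_ isT).
  by apply: le_trans; rewrite lerD2l ge_min lexx.
have p2 (J : {set 'I_n}) : J != finset.set0 -> J != finset.setT ->
    \sum_(i in J) mu i + ep <= \sum_(j | [exists i in J, compat M i j]) lam j.
  move=> J0 JT; have := gap2 J; rewrite J0 JT => /(_ isT).
  by apply: le_trans; rewrite lerD2l ge_min lexx orbT.
have l0' j : 0 <= lam j by exact: ltW.
have u0' i : 0 <= mu i by exact: ltW.
have [K0 blocking] := max_weight_blocking n0 ep0 l0' u0' lamu nbs nbc p1 p2.
rewrite /max_weight_bound -lamu.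
set Lam := \sum_j lam j in blocking *.
set D := \big[Num.max/0]_j _; set cs := \big[Num.max/0]_i _.
set cc := \big[Num.max/0]_j cost_c _ _; set c := Num.max cs cc.
set w := Num.sqrt n%:R.
have nR := nR_gt0 R n0.
have w0 : 0 < w by rewrite sqrtr_gt0.
have ww : w * w = n%:R by rewrite -expr2 sqr_sqrtr // ltW.
have D0 : 0 <= D by exact: bigmax_ge_id.
have c0 : 0 <= c by rewrite le_max bigmax_ge_id.
have L0 : 0 <= Lam by exact: sumr_ge0.
apply/lee_addgt0Pr => e e0; rewrite -EFinD; apply: limn_esup_le_near.
(* The terms ensure in turn that [K] exceeds [K0], that [r] is positive, and that rounding the
   buffer up, which costs at most [2 n c], stays within [e r]. *)
have [N rN] := @sqrt_large R (K0%:R * w + 1 + 2 * n%:R * c / e).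
exists N.+1 => // m /= Nm; rewrite lee_fin.
have m0 : (0 < m)%N by exact: leq_trans Nm.
have := rN m (ltnW Nm); set r := Num.sqrt m%:R => rg.
have ce : 0 <= 2 * n%:R * c / e by rewrite divr_ge0 // ?(ltW e0) // !mulr_ge0.
have Kw : 0 <= K0%:R * w by rewrite mulr_ge0 // ltW.
have r0 : 0 < r by lra.
have rr : r * r = m%:R by rewrite -expr2 sqr_sqrtr.
have tE : Num.sqrt (m%:R / n%:R) = r / w.
  by rewrite sqrtrM // sqrtrV // ltW.
rewrite tE; have t0 : 0 < r / w by rewrite divr_gt0.
have [K [Kq tK Kt]] := nat_cap (ltW t0).
have KK : (K0 < K)%N by rewrite -Kq ltr_pdivlMr //; lra.
have gr := max_weight_greedy (mw m).
have [E Es ->] := fluid_loss_steady opt l0' u0' gr m0 Kq.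
have ind0 (b : state n -> bool) : 0 <= E (fun q => (b q)%:R).
  by apply: (steady_ge0 Es) => q _.
have := blocking K (mt m) E KK (mw m) Es; rewrite -mulr_suml.
set A := \sum_j _ => AL.
have A0 : 0 <= A by exact: sum_mul_ge0.
set X := \sum_j lam j * _ * _; set Y := \sum_i mu i * _ * _; set Z := \sum_j _ * _ + _.
have Y0 : 0 <= Y by apply: sum_mul_ge0 => // i; rewrite mulr_ge0.
have XA : X <= D * A.
  rewrite /X /A mulr_sumr; apply: ler_sum => j _; rewrite mulrA ler_wpM2r //.
  by rewrite mulrC ler_wpM2r // le_bigmax.
have ZK : Z <= 2 * n%:R * c * K%:R.
  have len (h : state n -> nat) : (forall q, good K (compat M) q ->
      (h q <= K)%N) -> E (fun q => (h q)%:R) <= K%:R.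
    move=> hK; rewrite -[leRHS](steady_cst Es); apply: (steady_le Es) => q /hK.
    by rewrite ler_nat.
  have side (a b : 'I_n -> R) : (forall k, 0 <= a k) -> (forall k, a k <= c) ->
      (forall k, b k <= K%:R) -> \sum_k a k * b k <= n%:R * c * K%:R.
    move=> a0 ac bK; apply: le_trans (sum_mul_le a0 bK) _; apply: ler_wpM2r => //.
    apply: (@le_trans _ _ (\sum_(k < n) c)); first exact: ler_sum.
    by rewrite sumr_const card_ord mulr_natl.
  have -> : 2 * n%:R * c * K%:R = n%:R * c * K%:R + n%:R * c * K%:R by ring.
  apply: lerD; apply: side => // k.
  - by rewrite le_max le_bigmax orbT.
  - by apply: len => q [].
  - by rewrite le_max le_bigmax.
  - by apply: len => q [].
(* The buffer is at least [r / w] and [n = w^2], so [n K >= w r]. *)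
have Ar : A * (w * r) <= Lam.
  apply: le_trans AL; apply: ler_wpM2l => //.
  have -> : w * r = n%:R * (r / w) by rewrite -ww; field; exact: lt0r_neq0.
  by rewrite ler_wpM2l // ltW.
have mA : m%:R * A <= r * (Lam / w).
  rewrite -rr -mulrA ler_wpM2l // ?(ltW r0) // ler_pdivlMr //.
  by apply: le_trans Ar; rewrite le_eqVlt; apply/orP; left; apply/eqP; ring.
have mX : m%:R * X <= D * (r * (Lam / w)).
  by apply: (@le_trans _ _ (D * (m%:R * A))); rewrite ?ler_wpM2l // mulrCA ler_wpM2l.
have cK : 2 * n%:R * c * K%:R <= 2 * n%:R * c * (r / w + 1).
  by rewrite ler_wpM2l ?(ltW Kt) // !mulr_ge0.
have ne : 2 * n%:R * c <= e * r by rewrite [leRHS]mulrC -ler_pdivrMr //; lra.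
have mY : 0 <= m%:R * Y by rewrite mulr_ge0.
rewrite ler_pdivrMr //.
have -> : (w * ((Lam + Lam) / (2 * n%:R) * D + 2 * c) + e) * r =
    D * (r * (Lam / w)) + 2 * n%:R * c * (r / w) + e * r.
  by rewrite -ww; field; rewrite lt0r_neq0.
by rewrite mulrBr; lra.
Qed.

Theorem theorem4 (R : realType) :
  (* (i) *)
  (forall (n : nat) (M : market R n) (lam mu : 'I_n -> R)
      (chi : 'I_n -> 'I_n -> R) (gamma : R),
    (0 < n)%N -> 0 < gamma -> fluid_setting M lam mu chi ->
    (fun eta : nat => fluid_loss M lam mu (randomized chi)
                        (gamma * Num.sqrt eta%:R) eta)
      =O_\oo (fun eta : nat => Num.sqrt (eta%:R : R)))
  /\
  (* (ii) *)
  (forall gamma : R, 0 < gamma ->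
    exists (M : forall n, market R n) (lam mu : forall n, 'I_n -> R)
      (chi : forall n, 'I_n -> 'I_n -> R),
      (forall n, (0 < n)%N ->
         fluid_setting (M n) (lam n) (mu n) (chi n) /\
         pooling (M n) (lam n) (mu n)) /\
      (exists C : R, forall n, (0 < n)%N -> data_le (M n) (lam n) (mu n) C) /\
      (exists2 c : R, 0 < c &
         \forall n \near \oo,
           ((c * n%:R)%:E <=
            limn_einf (fun eta : nat =>
              (fluid_loss (M n) (lam n) (mu n) (randomized (chi n))
                 (gamma * Num.sqrt eta%:R) eta / Num.sqrt eta%:R)%:E))%E))
  /\
  (* (iii) *)
  ((forall (n : nat) (M : market R n) (lam mu : 'I_n -> R)
      (chi : 'I_n -> 'I_n -> R) (mt : nat -> matching R n),
    (0 < n)%N -> fluid_setting M lam mu chi -> pooling M lam mu ->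
    (forall eta, max_weight M (mt eta)) ->
    (limn_esup (fun eta : nat =>
       (fluid_loss M lam mu (mt eta) (Num.sqrt (eta%:R / n%:R)) eta
          / Num.sqrt eta%:R)%:E)
     <= (max_weight_bound M lam mu)%:E)%E)
  /\
  (forall (M : forall n, market R n) (lam mu : forall n, 'I_n -> R)
      (chi : forall n, 'I_n -> 'I_n -> R) (C : R),
    (forall n, (0 < n)%N ->
       [/\ fluid_setting (M n) (lam n) (mu n) (chi n),
           pooling (M n) (lam n) (mu n) & data_le (M n) (lam n) (mu n) C]) ->
    (fun n : nat => max_weight_bound (M n) (lam n) (mu n))
      =O_\oo (fun n : nat => Num.sqrt (n%:R : R)))).
Proof.
split; first by move=> n M lam mu chi gamma _ g0; exact: randomized_loss.
split.
  move=> gamma g0; exists (affine_market R), (fun n => fun=> 1), (fun n => fun=> 1),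
    (@diagonal R); split=> [n n0|].
    by split; [exact: affine_market_setting|exact: affine_market_pooling].
  (* The largest datum of the affine market is the demand price 2 at rate 1. *)
  split; first by exists 2 => n _; split => k; split => //=; lra.
  exists (3 / 10 / gamma); first by rewrite !divr_gt0.
  by near=> n; exact: affine_market_loss.
split; first by move=> n M lam mu chi mt; exact: max_weight_loss.
move=> M lam mu chi C H; apply: (@max_weight_bound_bigO _ _ _ _ chi C) => n n0.
by have [] := H n n0.
Unshelve. all: by end_near. Qed.
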